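(* Let $d=3$, let $I\subset\mathbb{R}$ be a compact interval, and suppose that $Q(\mathbf n)=n_1^2+n_2^2+\theta_3n_3^2$ for $\mathbf n\in\mathbb{Z}^3$, with $\theta_3>0$. Then for every $p>\frac{14}{3}$ the scaling-invariant Strichartz estimate $$\|e^{-it\Delta}f\|_{L^p_{t,\mathbf x}(I\times\mathbb{T}^3)}\lesssim N^{\frac32-\frac5p}\|f\|_{L^2(\mathbb{T}^3)}$$ holds for all $N\ge1$ and all $f\in L^2(\mathbb{T}^3)$ with $\operatorname{supp}\widehat f\subset[-N,N]^3$.
   Context: $\mathbb{T}^3=(\mathbb{R}/\mathbb{Z})^3$, $\widehat f(\mathbf n)=\int_{\mathbb{T}^3}f(\mathbf x)e^{-2\pi i\mathbf n\cdot\mathbf x}\,d\mathbf x$, and $$e^{-it\Delta}f(\mathbf x)=\sum_{\mathbf n\in\mathbb{Z}^3}\widehat f(\mathbf n)e^{2\pi i(\mathbf n\cdot\mathbf x+Q(\mathbf n)t)}.$$ $A\lesssim B$ means $A\le C'B$ for a constant $C'>0$ independent of $N$ and $f$ (depending on $p$, $\theta_3$ and the length of $I$). *)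

(* Defs.v *)
From HB Require Import structures.
From mathcomp Require Import all_boot all_order all_algebra.
From mathcomp Require Import all_classical all_reals all_analysis.
From mathcomp Require Import complex.

Set Implicit Arguments.
Unset Strict Implicit.
Unset Printing Implicit Defensive.

Import Order.TTheory GRing.Theory Num.Theory.
Import numFieldNormedType.Exports.

Local Open Scope classical_set_scope.
Local Open Scope ring_scope.
Local Open Scope complex_scope.

Section ComplexIntegration.
Context d (T : measurableType d) (R : realType).
Implicit Types (mu : {measure set T -> \bar R}) (D : set T) (f : T -> R[i]).

Definition cmeasurable_fun D f : Prop :=
  measurable_fun D (fun x => complex.Re (f x)) /\
  measurable_fun D (fun x => complex.Im (f x)).

Definition cintegral mu D f : R[i] :=
  (\int[mu]_(x in D) complex.Re (f x)) +i* (\int[mu]_(x in D) complex.Im (f x)).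

(* ComplexField.Normc.normc is the modulus with values in R, whereas `|_| on
   R[i] takes values in R[i]. *)
Definition cLnorm mu D (p : R) f : \bar R :=
  Lnorm mu p%:E ((fun x => (ComplexField.Normc.normc (f x))%:E) \_ D).

End ComplexIntegration.

Section ProductMeasure.
Context d1 d2 (T1 : measurableType d1) (T2 : measurableType d2) (R : realType).
Context (m1 : {sigma_finite_measure set T1 -> \bar R}).
Context (m2 : {sigma_finite_measure set T2 -> \bar R}).

Lemma product_measure_sigma_finite : sigma_finite setT (m1 \x m2)%E.
Proof.
have /sigma_finiteP[F [TF ndF Foo]] := sigma_finiteT m1.
have /sigma_finiteP[G [TG ndG Goo]] := sigma_finiteT m2.
exists (fun n => F n `*` G n).
  rewrite -setXTT TF TG predeqE => -[x y]; split.
    move=> [/= [n _ Fnx] [k _ Gky]]; exists (maxn n k) => //; split.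
    - by move: x Fnx; exact/subsetPset/ndF/leq_maxl.
    - by move: y Gky; exact/subsetPset/ndG/leq_maxr.
  by move=> [n _ []/= ? ?]; split; exists n.
move=> k; have [? ?] := Foo k; have [? ?] := Goo k.
split; first exact: measurableX.
by rewrite product_measure1E// lte_mul_pinfty// ge0_fin_numE.
Qed.

End ProductMeasure.

(* Inference finds no sigma-finite structure on m1 \x m2 unless m1 and m2 are
   subprobabilities, hence these named measures with explicit instances. *)
Section LebesgueMeasures.
Context (R : realType).

Definition lebesgue2 := (@lebesgue_measure R \x @lebesgue_measure R)%E.
HB.instance Definition _ := Measure.on lebesgue2.
HB.instance Definition _ := Measure_isSigmaFinite.Build _ _ _ lebesgue2
  (product_measure_sigma_finite lebesgue_measure lebesgue_measure).

Definition lebesgue3 := (lebesgue2 \x @lebesgue_measure R)%E.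
HB.instance Definition _ := Measure.on lebesgue3.
HB.instance Definition _ := Measure_isSigmaFinite.Build _ _ _ lebesgue3
  (product_measure_sigma_finite lebesgue2 lebesgue_measure).

Definition lebesgue_spacetime := (@lebesgue_measure R \x lebesgue3)%E.
HB.instance Definition _ := Measure.on lebesgue_spacetime.
HB.instance Definition _ := Measure_isSigmaFinite.Build _ _ _ lebesgue_spacetime
  (product_measure_sigma_finite lebesgue_measure lebesgue3).

End LebesgueMeasures.

Section Torus.
Context (R : realType).
Implicit Types (n : int * int * int) (x : R * R * R).

(* Functions on the torus (R/Z)^3 are Z^3-periodic functions on R^3, and they
   are integrated over the fundamental domain [0, 1[^3. *)
Definition torus_cell : set (R * R * R) :=
  `[0, 1[ `*` `[0, 1[ `*` `[0, 1[.

Definition torus_periodic (f : R * R * R -> R[i]) : Prop :=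
  forall x n, f (x.1.1 + n.1.1%:~R, x.1.2 + n.1.2%:~R, x.2 + n.2%:~R) = f x.

Definition L2norm_torus (f : R * R * R -> R[i]) : \bar R :=
  cLnorm (@lebesgue3 R) torus_cell 2 f.

Definition L2_torus (f : R * R * R -> R[i]) : Prop :=
  [/\ torus_periodic f, cmeasurable_fun torus_cell f
    & (L2norm_torus f < +oo)%E].

Definition dot3 n x : R :=
  n.1.1%:~R * x.1.1 + n.1.2%:~R * x.1.2 + n.2%:~R * x.2.

(* e2pi s = exp (2 pi i s) *)
Definition e2pi (s : R) : R[i] := cos (2 * pi * s) +i* sin (2 * pi * s).

Definition fourier_coef (f : R * R * R -> R[i]) n : R[i] :=
  cintegral (@lebesgue3 R) torus_cell (fun x => f x * e2pi (- dot3 n x)).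

Definition cube (N : R) : set (int * int * int) :=
  [set n | [/\ `|n.1.1%:~R| <= N, `|n.1.2%:~R| <= N & `|n.2%:~R| <= N]].

(* The Fourier multiplier exp (2 pi i Q(n) t) applied to f; the series over Z^3
   is the pointwise limit of its cubic partial sums.  When fourier_coef f has
   finite support these sums are eventually constant. *)
Definition schrodinger (Q : int * int * int -> R) (f : R * R * R -> R[i])
    (t : R) x : R[i] :=
  lim ((fun M : nat => (\sum_(n \in cube M%:R)
          fourier_coef f n * e2pi (dot3 n x + Q n * t) : R[i]^o)) @ \oo).

Definition Qform (theta3 : R) n : R :=
  n.1.1%:~R ^+ 2 + n.1.2%:~R ^+ 2 + theta3 * n.2%:~R ^+ 2.

End Torus.

(* Main.v *)
Require Import Defs.
From mathcomp Require Import all_boot all_order all_algebra.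
From mathcomp Require Import all_classical all_reals all_analysis.
From mathcomp Require Import measurable_realfun.
From mathcomp Require Import complex.
From mathcomp Require Import ring lra.
From mathcomp Require Import zify.

Set Implicit Arguments.
Unset Strict Implicit.
Unset Printing Implicit Defensive.

Import Order.TTheory GRing.Theory Num.Theory.
Import numFieldNormedType.Exports.

Local Open Scope classical_set_scope.
Local Open Scope ring_scope.

(** The proof is a TT* argument run separately at every height, in which the only
arithmetic input is a bound on how often a quadratic Weyl sum is large.

Let [M] be the number of frequencies in each direction and let [K (s, y)] be the
sum of [exp (2 pi i (n . y + Q n s))] over the cube of frequencies.  Because [Q]
is diagonal, [K] is a product of three one-dimensional Weyl sums, two of them at
time [s] and the third at time [theta3 s].

Weyl sums.  Differencing bounds the square of a one-dimensional sum by
[M + 2 sum_h min (M, 1 / |sin (pi h s)|)] ([weyl_differencing]).  Dirichlet's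
theorem puts [s] near a reduced fraction [a / q]; the [h] that are not multiples
of [q] contribute [O (M ln M)], while the multiples contribute at most
[M ^ 2 / q], and also at most [M / sqrt (q |q s - a|)] ([sum_geo_bound_le]).
Hence the square exceeds [M ^ 2 / rho] only if [q <= 8 rho] and [s] lies within
[O (rho ^ 2 / (q M) ^ 2)] of [a / q], which happens on a set of times of measure
[O (rho ^ (2 + eps) / M ^ 2)] ([weyl_exceptional]).  When [rho] is so large that
the error [M ln M] matters, this bound exceeds a constant and the whole time
interval is allowed as exceptional set.

Superlevel sets.  Let [F] be the evolution of a datum whose coefficients [c]
have sum of squares [S], and let [E] be the part of the slab where
[|F| ^ 2 > lam2].  Put [X] for the integral of [|F| ^ 2] over [E] and [d_i] for
the integral over [E] of the real inner product of [F] with the [i]-th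
exponential.  Then [X = sum c_i d_i], so
[X ^ 2 <= S sum d_i ^ 2], and [sum d_i ^ 2] is a double integral over pairs of
times.  If the difference of the two times avoids the set [A] on which [K] can
exceed [tau], the kernel bound gives [tau (int_E |F|) ^ 2]; if it falls in [A],
Bessel's inequality in space at both times gives [|A| X] ([TTstar_bound]).  Since
[|F| > sqrt lam2] on [E], the choice [lam2 = 2 S tau] absorbs the first term and
leaves [tau |E| <= |A|] ([superlevel_bound]).

Summation.  With [rho = 16 ^ k] and [tau = (M / 4 ^ k) ^ 3] the heights
[lam2] run down a geometric progression from the trivial upper bound
[|F| ^ 2 <= S M ^ 3], and the contributions of the levels to the integral of
[|F| ^ p] form a geometric series of ratio [2 ^ (14 + 4 eps - 3 p)]
([wave_power_bound]).  It converges exactly because [p > 14 / 3], with the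
scaling-invariant power of [M] in front and no loss in [M].

Complex functions are handled through real ones: a frequency [n] gives two
indices, with phases [2 pi (n . x + Q n t)] and the same plus [pi / 2], so that
the real and imaginary parts of a Fourier coefficient become two real
coefficients of a real orthonormal system of plane vector fields [(cos, sin)]. *)

(** * Trigonometric estimates *)

Section Trig.
Context {R : realType}.
Implicit Types (t x y : R).

(** The double angle formula turns [y cos y <= sin y] at [y = x / 2] into
    [sin x >= x (cos y) ^ 2 = x (1 + cos x) / 2]. *)
Lemma sin_ge_half x : 0 <= x <= pi / 2 -> x / 2 <= sin x.
Proof.
move=> /andP[x0 xpi].
have pi0 : 0 < pi :> R := pi_gt0 R.
have cmp (y : R) : 0 <= y <= pi / 2 -> y * cos y <= sin y.
  move=> /andP[y0 ypi].
  have [->|yn0] := eqVneq y 0; first by rewrite mul0r sin0.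
  have ygt0 : 0 < y by rewrite lt_def yn0.
  have [c /andP[c0 cy]] : exists2 c, 0 < c < y & sin y - sin 0 = cos c * (y - 0).
    have [c] := @MVT R sin cos 0 y ygt0 (fun x _ => is_derive_sin x)
      (continuous_subspaceT (@continuous_sin R)).
    by rewrite in_itv/= => ? ?; exists c.
  rewrite sin0 !subr0 => ->; rewrite mulrC ler_pM2r//.
  have [//|cyn] := lerP (cos y) (cos c).
  move: cyn; rewrite ltr_cos ?in_itv/=; lra.
have h2 : 0 <= x / 2 <= pi / 2 by lra.
have := cmp _ h2; set y := x / 2 => cy.
have xE : x = y *+ 2 by rewrite /y mulr2n; lra.
have cosy : 0 <= cos y by apply: cos_ge0_pihalf; rewrite /y; lra.
have cosx : 0 <= cos x by apply: cos_ge0_pihalf; lra.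
have yge0 : 0 <= y by rewrite /y; lra.
move: cosx; rewrite xE sin_mulr2n cos_mulr2n !mulr2n => cosx.
rewrite -/y in cy.
have : y * cos y ^+ 2 <= cos y * sin y by rewrite expr2 mulrA mulrC ler_wpM2l.
nra.
Qed.

Lemma sin_pi_ge y : 0 <= y <= 1 -> y * (1 - y) <= sin (pi * y).
Proof.
have pi2 : 2 <= pi :> R := pi_ge2 R.
have half (z : R) : 0 <= z <= 1 / 2 -> z * (1 - z) <= sin (pi * z).
  move=> /andP[z0 z1].
  have : (pi * z) / 2 <= sin (pi * z) .
    by have := @sin_ge_half (pi * z); apply; apply/andP; split; nra.
  nra.
move=> /andP[y0 y1]; have [yh|yh] := lerP y (1/2); first by apply: half; lra.
have -> : pi * y = pi - pi * (1 - y) by ring.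
rewrite sinB sinpi cospi mul0r sub0r mulN1r opprK.
have : (1 - y) * (1 - (1 - y)) <= sin (pi * (1 - y)) by apply: half; lra.
by rewrite subKr mulrC.
Qed.

Lemma sin_shift_nat x (k : nat) : `|sin (x + pi * k%:R)| = `|sin x|.
Proof.
elim: k => [|k IH]; first by rewrite mulr0 addr0.
by rewrite -natr1 mulrDr mulr1 addrA sinDpi normrN.
Qed.

Lemma norm_sin_shift x (k : int) : `|sin (x + pi * k%:~R)| = `|sin x|.
Proof.
case: k => k; first by rewrite sin_shift_nat.
rewrite NegzE mulrNz mulrN -(sin_shift_nat _ k.+1).
by congr (`|sin _|); rewrite -pmulrn subrK.
Qed.

(** Multiplying by [sin (th / 2)] makes the sum telescope; this is the
    geometric series bound. *)
Lemma sum_cos_arith (A th : R) (m : nat) :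
  `|\sum_(0 <= j < m) cos (A + j%:R * th)| * `|sin (th / 2)| <= 1.
Proof.
rewrite -normrM mulr_suml.
have tele : forall j : nat, cos (A + j%:R * th) * sin (th / 2) =
   sin (A + j.+1%:R * th - th / 2) / 2 - sin (A + j%:R * th - th / 2) / 2.
  move=> j.
  have -> : A + j.+1%:R * th - th / 2 = (A + j%:R * th) + th / 2.
    by rewrite -natr1; field.
  set u := A + _; set v := th / 2.
  by rewrite (sinD u v) (sinB u v); field.
rewrite (eq_bigr _ (fun j _ => tele j)) telescope_sumr//.
have h1 := @sin_max R (A + m%:R * th - th / 2).
have h2 := @sin_max R (A + 0%:R * th - th / 2).
rewrite (le_trans (ler_normB _ _))// !normrM (@ger0_norm _ 2^-1) ?invr_ge0//.
lra.
Qed.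

Lemma periodic_int (f : R -> R) : (forall x, f (x + pi *+ 2) = f x) ->
  forall x (k : int), f (x + 2 * pi * k%:~R) = f x.
Proof.
move=> hf x k; have nat_per z (n : nat) : f (z + 2 * pi * n%:R) = f z.
  elim: n => [|n IH]; first by rewrite mulr0 addr0.
  have -> : z + 2 * pi * n.+1%:R = (z + 2 * pi * n%:R) + pi *+ 2.
    by rewrite -[n.+1%:R]natr1 mulr2n; ring.
  by rewrite hf.
case: k => k; first by rewrite nat_per.
by rewrite NegzE mulrNz mulrN -[LHS](nat_per _ k.+1) -pmulrn subrK.
Qed.

(** van der Corput's differencing identity *)
Lemma sum_cos_sin_sqr (ph : nat -> R) (M : nat) :
  (\sum_(0 <= i < M) cos (ph i)) ^+ 2 + (\sum_(0 <= i < M) sin (ph i)) ^+ 2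
  = M%:R + 2 * \sum_(1 <= h < M) \sum_(0 <= j < M - h) cos (ph (j + h)%N - ph j).
Proof.
elim: M => [|M IH].
  by rewrite !big_geq// !expr0n/= addr0 mulr0 addr0.
rewrite !(@big_nat_recr _ _ _ M 0)//=.
set C := \sum_(0 <= i < M) cos (ph i) in IH *.
set S := \sum_(0 <= i < M) sin (ph i) in IH *.
have -> : (C + cos (ph M)) ^+ 2 + (S + sin (ph M)) ^+ 2 =
  (C ^+ 2 + S ^+ 2) + (cos (ph M) ^+ 2 + sin (ph M) ^+ 2)
  + 2 * (C * cos (ph M) + S * sin (ph M)) by ring.
rewrite IH cos2Dsin2.
have -> : C * cos (ph M) + S * sin (ph M) =
  \sum_(1 <= h < M.+1) cos (ph M - ph (M - h)%N).
  rewrite big_add1/= /C /S !mulr_suml -big_split/= big_nat_rev/=.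
  by apply: eq_bigr => i _; rewrite add0n cosB [LHS]addrC addrC mulrC [X in _ + X]mulrC.
have -> : \sum_(1 <= h < M.+1) \sum_(0 <= j < M.+1 - h) cos (ph (j + h)%N - ph j)
 = \sum_(1 <= h < M.+1) ((\sum_(0 <= j < M - h) cos (ph (j + h)%N - ph j)) +
     cos (ph M - ph (M - h)%N)).
  apply: eq_big_nat => h /andP[h1 hM].
  by rewrite subSn// big_nat_recr//= subnK.
rewrite big_split/=.
have -> : \sum_(1 <= h < M.+1) \sum_(0 <= j < M - h) cos (ph (j + h)%N - ph j)
 = \sum_(1 <= h < M) \sum_(0 <= j < M - h) cos (ph (j + h)%N - ph j).
  case: M {IH C S} => [|M]; first by rewrite !big_geq.
  by rewrite big_nat_recr//= subnn [X in _ + X]big_geq// addr0.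
rewrite -natr1; ring.
Qed.

End Trig.
(** * Weyl differencing and sums over residue classes *)

Section Weyl.
Context {R : realType}.
Implicit Types (t y th : R) (M q : nat).

(** The bound [min (M, 1 / |sin (pi th)|)] for a geometric sum of at most [M]
    terms, in a form that still gives [M] when the sine vanishes. *)
Definition geo_bound M th : R := M%:R / Num.max 1 (M%:R * `|sin (pi * th)|).

Lemma geo_bound_ge0 M th : 0 <= geo_bound M th.
Proof. by rewrite divr_ge0// le_max ler01. Qed.

Lemma geo_bound_inv M th c : 0 < c -> c <= `|sin (pi * th)| -> geo_bound M th <= c^-1.
Proof.
move=> c0 cs; rewrite ler_pdivrMr ?lt_max ?ltr01//.
by rewrite ler_pdivlMl// le_max mulrC ler_wpM2l ?orbT.
Qed.

Lemma geo_bound_shift M th (k : int) : geo_bound M (th + k%:~R) = geo_bound M th.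
Proof. by rewrite /geo_bound mulrDr norm_sin_shift. Qed.

Lemma sum_cos_le_geo_bound M m (A th : R) : (m <= M)%N ->
  `|\sum_(0 <= j < m) cos (A + j%:R * (2 * pi * th))| <= geo_bound M th.
Proof.
move=> mM; rewrite ler_pdivlMr ?lt_max ?ltr01//.
have h1 : `|\sum_(0 <= j < m) cos (A + j%:R * (2 * pi * th))| <= M%:R.
  rewrite (le_trans (ler_norm_sum _ _ _))//.
  rewrite (le_trans (ler_sum _ (fun i _ => cos_max _)))//.
  by rewrite sumr_const_nat subn0 ler_nat.
have := sum_cos_arith A (2 * pi * th) m.
have -> : 2 * pi * th / 2 = pi * th by field.
have S0 : 0 <= `|\sum_(0 <= j < m) cos (A + j%:R * (2 * pi * th))| by [].
move: S0 h1; set S := `|_| => S0 h1 h2.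
rewrite maxr_pMr// ge_max mulr1 h1/= mulrCA -[leRHS]mulr1.
exact: ler_wpM2l.
Qed.

(** The squared modulus of the quadratic exponential sum at time [t], frequency shift [y]. *)
Definition weyl2 M y t : R :=
  (\sum_(0 <= i < M) cos (2 * pi * (i%:R * y + i%:R ^+ 2 * t))) ^+ 2 +
  (\sum_(0 <= i < M) sin (2 * pi * (i%:R * y + i%:R ^+ 2 * t))) ^+ 2.

Lemma sum_even_le (g : nat -> R) M : (forall h, 0 <= g h) ->
  \sum_(1 <= h < M) g h.*2 <= \sum_(1 <= h < M.*2) g h.
Proof.
move=> g0; case: M => [|M]; first by rewrite !big_geq.
elim: M => [|M IH]; first by rewrite big_geq// sumr_ge0.
rewrite big_nat_recr//= (@big_nat_recr _ _ _ M.+1.*2.+1)//= (@big_nat_recr _ _ _ M.+1.*2)//=.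
rewrite -addrA lerD// -[leLHS]addr0 lerD//.
Qed.

(** The differenced phase is affine in [j] with slope [2 h t], so every inner sum
    is geometric; the even multiples [2 h] are then among all [h < 2 M]. *)
Lemma weyl_differencing M y t :
  weyl2 M y t <= M%:R + 2 * \sum_(1 <= h < M.*2) geo_bound M (h%:R * t).
Proof.
rewrite /weyl2 sum_cos_sin_sqr lerD2l ler_pM2l//.
rewrite (le_trans _ (sum_even_le M (fun h => geo_bound_ge0 M (h%:R * t))))//.
apply: ler_sum_nat => h /andP[h1 hM].
rewrite (le_trans (ler_norm _))//.
rewrite (eq_bigr (fun j : nat => cos ((2 * pi * (h%:R * y + h%:R ^+ 2 * t)) +
   j%:R * (2 * pi * (h.*2%:R * t))))).
  by apply: sum_cos_le_geo_bound; rewrite leq_subr.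
by move=> j _; congr cos; rewrite natrD -mul2n natrM; ring.
Qed.

(** [1 / r <= ln r - ln (r - 1)] is the inequality [ln (1 - 1 / r) <= - 1 / r]. *)
Lemma harmonic_le (q : nat) : (0 < q)%N ->
  \sum_(1 <= r < q.+1) (r%:R^-1 : R) <= 1 + ln q%:R.
Proof.
case: q => // q _; elim: q => [|q IH]; first by rewrite big_nat1 invr1 ln1 addr0.
rewrite big_nat_recr//= (le_trans (lerD IH (lexx _)))// -addrA lerD2l.
have q1 : 0 < q.+1%:R :> R by [].
have q2 : 0 < q.+2%:R :> R by [].
have := @le_ln1Dx R (- q.+2%:R^-1).
have -> : 1 + - q.+2%:R^-1 = q.+1%:R / q.+2%:R :> R.
  by rewrite -[q.+1%:R](addrK 1) natr1 mulrBl divff// mul1r.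
rewrite ltrN2 invf_lt1// ltr1n => /(_ isT).
by rewrite ln_div ?posrE// lerBlDl lerBrDr.
Qed.

Lemma sum_inv_sqrt_le (n : nat) :
  \sum_(1 <= k < n.+1) (Num.sqrt (k%:R^-1 : R)) <= 2 * Num.sqrt n%:R.
Proof.
elim: n => [|n IH]; first by rewrite big_geq// mulr_ge0.
rewrite big_nat_recr//= (le_trans (lerD IH (lexx _)))//.
rewrite sqrtrV//.
have s1 : 0 < Num.sqrt n.+1%:R :> R by rewrite sqrtr_gt0.
have s0 : 0 <= Num.sqrt n%:R :> R by [].
have e1 : Num.sqrt n.+1%:R ^+ 2 = n%:R + 1 :> R by rewrite sqr_sqrtr// natr1.
have e0 : Num.sqrt n%:R ^+ 2 = n%:R :> R by rewrite sqr_sqrtr.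
set a := Num.sqrt n.+1%:R in s1 e1 *; set b := Num.sqrt n%:R in s0 e0 *.
rewrite -(ler_pM2r s1) mulrDl mulVf ?gt_eqF//.
nra.
Qed.

(** Multiplication by [a] permutes the residues modulo [q]. *)
Lemma sum_coprime_mod (f : nat -> R) (q a : nat) : (0 < q)%N -> coprime a q ->
  \sum_(0 <= i < q) f ((i * a) %% q)%N = \sum_(0 <= r < q) f r.
Proof.
case: q => // q _ aq; rewrite !big_mkord.
pose h (i : 'I_q.+1) : 'I_q.+1 := inord ((i * a) %% q.+1).
have hE i : h i = ((i * a) %% q.+1)%N :> nat by rewrite inordK// ltn_mod.
have hinj : injective h.
  move=> i j /(congr1 val)/=; rewrite !hE => /eqP.
  have aux (x z : nat) : (x <= z)%N -> (z < q.+1)%N ->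
      (z * a == x * a %[mod q.+1])%N -> x = z.
    move=> xz zq; rewrite eqn_mod_dvd ?leq_mul2r ?xz ?orbT// -mulnBl.
    rewrite Gauss_dvdl 1?coprime_sym// => qd.
    apply/eqP; rewrite eqn_leq xz/= -subn_eq0.
    have := dvdn_leq _ qd; case: posnP => [->//|_ /(_ isT)].
    by rewrite leqNgt (leq_ltn_trans (leq_subr _ _) zq).
  move=> ij; apply: val_inj => /=.
  have [le|/ltnW le] := leqP i j.
    by apply: aux => //; rewrite eq_sym.
  by symmetry; apply: aux.
rewrite [RHS](reindex_inj hinj).
by apply: eq_bigr => i _; rewrite hE.
Qed.

(** In each block of [q] consecutive integers exactly one is a multiple of [q], and
    the others run through the nonzero residues after multiplication by [a]. *)
Lemma sum_blocks (f g : nat -> R) (q a B : nat) : (0 < q)%N -> coprime a q ->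
  \sum_(0 <= h < B * q) (if (q %| h)%N then g (h %/ q)%N else f ((h * a) %% q)%N)
  = \sum_(0 <= k < B) g k + B%:R * \sum_(1 <= r < q) f r.
Proof.
move=> q0 aq; elim: B => [|B IH].
  by rewrite mul0n [LHS]big_geq// [X in X + _]big_geq// add0r mul0r.
rewrite mulSn addnC (@big_cat_nat _ _ _ (B * q)%N)//= ?leq_addr// IH.
rewrite (@big_nat_recr _ _ _ B)//=.
rewrite -{1}[(B * q)%N]add0n big_addn addnC addnK.
rewrite (_ : \sum_(0 <= i < q) _ = \sum_(0 <= i < q) (if i == 0%N then g B else f ((i * a) %% q)%N)); last first.
  apply: eq_big_nat => i /andP[_ iq]; rewrite addnC dvdn_addr ?dvdn_mull//.
  case: eqVneq => [->|i0]; first by rewrite dvdn0 addn0 mulnK.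
  by rewrite gtnNdvd ?lt0n// mulnDl -mulnA [(q * a)%N]mulnC mulnA modnMDl.
have := sum_coprime_mod f q0 aq.
rewrite (@big_ltn _ _ _ 0 q)// mul0n mod0n [X in _ = X](@big_ltn _ _ _ 0 q)// => /addrI fE.
have -> : \sum_(0 <= i < q) (if i == 0%N then g B else f ((i * a) %% q)%N)
    = g B + \sum_(1 <= i < q) f ((i * a) %% q)%N.
  rewrite big_ltn//=; congr (_ + _); apply: eq_big_nat => i /andP[i0 _].
  by rewrite gtn_eqF.
rewrite fE -natr1; ring.
Qed.

End Weyl.
(** * Weyl sums near a rational point *)

Section MajorArcs.
Context {R : realType}.
Implicit Types (t y th : R) (M q X : nat).

(** Pigeonhole: two of the [X + 1] numbers [i t] have fractional parts in the same
    interval of length [1 / X]; dividing by the gcd makes the fraction reduced. *)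
Lemma dirichlet_nat t X : 0 <= t -> (0 < X)%N ->
  exists q a : nat, [/\ (0 < q <= X)%N, coprime a q & `|q%:R * t - a%:R| <= X%:R^-1].
Proof.
case: X => // X t0 _.
pose fr i : R := i%:R * t - (Num.truncn (i%:R * t))%:R.
have fr01 i : 0 <= fr i < 1.
  have : 0 <= i%:R * t by rewrite mulr_ge0.
  move=> /truncn_itv; rewrite -natr1 /fr; lra.
have X0 : 0 < X.+1%:R :> R by [].
have bX i : (Num.truncn (X.+1%:R * fr i) < X.+1)%N.
  have /andP[f0 f1] := fr01 i.
  by rewrite truncn_lt_nat ?mulr_ge0// -[ltRHS]mulr1 ltr_pM2l.
pose box (i : 'I_X.+2) : 'I_X.+1 := Ordinal (bX i).
have /injectivePn[i [j ij bij]] : ~~ injectiveb box.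
  apply/injectiveP => /leq_card; rewrite !card_ord; by rewrite ltnn.
wlog {ij} ij : i j bij / (i < j)%N.
  move=> H; move: ij; rewrite neq_ltn => /orP[|] ij; first exact: (H i j).
  exact: (H j i).
have close : `|fr j - fr i| <= X.+1%:R^-1.
  have /andP[fi0 fi1] := fr01 i; have /andP[fj0 fj1] := fr01 j.
  have /truncn_itv ti : 0 <= X.+1%:R * fr i by rewrite mulr_ge0.
  have /truncn_itv tj : 0 <= X.+1%:R * fr j by rewrite mulr_ge0.
  have E : Num.truncn (X.+1%:R * fr i) = Num.truncn (X.+1%:R * fr j) by case: bij.
  move: ti tj; rewrite E; set m := Num.truncn _.
  have -> : m.+1%:R = m%:R + 1 :> R by rewrite natr1.
  move=> ti tj.
  rewrite -[leRHS]mul1r ler_pdivlMr// -[X in _ * X](gtr0_norm X0) -normrM ler_norml.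
  rewrite mulrC mulrBr; move: ti tj.
  set u := X.+1%:R * fr i; set v := X.+1%:R * fr j; lra.
pose q := (j - i)%N; pose a := (Num.truncn (j%:R * t) - Num.truncn (i%:R * t))%N.
have tle : (Num.truncn (i%:R * t) <= Num.truncn (j%:R * t))%N.
  by apply: le_truncn; rewrite ler_wpM2r// ler_nat ltnW.
have q0 : (0 < q)%N by rewrite subn_gt0.
have qX : (q <= X.+1)%N by rewrite (leq_trans (leq_subr _ _))// -ltnS.
have qa : `|q%:R * t - a%:R| <= X.+1%:R^-1.
  rewrite (_ : _ - _ = fr j - fr i)// /q /a !natrB// ?(ltnW ij)// /fr; ring.
pose g := gcdn q a.
have g0 : (0 < g)%N by rewrite gcdn_gt0 q0.
exists (q %/ g)%N, (a %/ g)%N; split.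
- rewrite divn_gt0// dvdn_leq ?dvdn_gcdl//=.
  exact: leq_trans (leq_div _ _) qX.
- rewrite coprime_sym /coprime -(eqn_pmul2r g0) mul1n muln_gcdl.
  by rewrite !divnK ?dvdn_gcdl ?dvdn_gcdr.
- have gR : 1 <= g%:R :> R by rewrite ler1n.
  rewrite (le_trans _ qa)//.
  have -> : q%:R * t - a%:R = g%:R * ((q %/ g)%:R * t - (a %/ g)%:R).
    rewrite -[in LHS](divnK (dvdn_gcdl q a)) -[in X in _ - X](divnK (dvdn_gcdr q a)).
    rewrite -/g !natrM; ring.
  by rewrite normrM ler_peMl// ger0_norm// ler0n.
Qed.

Lemma dirichlet t X : (0 < X)%N ->
  exists (q a : nat) (c : int), [/\ (0 < q <= X)%N, coprime a q &
    `|q%:R * (t - c%:~R) - a%:R| <= X%:R^-1].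
Proof.
move=> X0; have [] := @dirichlet_nat (t - (Num.floor t)%:~R) X _ X0.
  by rewrite subr_ge0 floor_le.
by move=> q [a ?]; exists q, a, (Num.floor t).
Qed.

Lemma sum_residues_le q : (0 < q)%N ->
  \sum_(1 <= r < q) (2 * q%:R * (r%:R^-1 + (q - r)%:R^-1) : R)
    <= 4 * q%:R * (1 + ln q%:R).
Proof.
move=> q0; rewrite -mulr_sumr big_split/=.
have h : \sum_(1 <= r < q) (r%:R^-1 : R) <= 1 + ln q%:R.
  by rewrite (le_trans _ (harmonic_le q0))// (@big_nat_recr _ _ _ q)//= lerDl.
rewrite [X in _ + X]big_nat_rev/=.
have -> : \sum_(1 <= i < q) ((q - (1 + q - i.+1))%:R^-1 : R) = \sum_(1 <= r < q) r%:R^-1.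
  apply: eq_big_nat => i /andP[i1 iq]; rewrite add1n subSS subKn//; exact: ltnW.
have -> : 4 * q%:R * (1 + ln q%:R) = 2 * q%:R * ((1 + ln q%:R) + (1 + ln q%:R)) :> R by ring.
by rewrite ler_wpM2l ?mulr_ge0// lerD.
Qed.

Section Arc.
Variables (M q a : nat) (t : R).
Hypotheses (M0 : (0 < M)%N) (q0 : (0 < q)%N) (aq : coprime a q).
Hypothesis (qM : (q <= 8 * M)%N).
Let b : R := `|q%:R * t - a%:R|.
Hypothesis (bM : b <= (8 * M)%:R^-1).

Let M_gt0 : 0 < M%:R :> R. Proof. by rewrite ltr0n. Qed.
Let q_gt0 : 0 < q%:R :> R. Proof. by rewrite ltr0n. Qed.

Let bM' (h : nat) : (h < M.*2)%N -> h%:R * b <= 1 / 4.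
Proof.
move=> hM; have : h%:R <= 2 * M%:R :> R by rewrite -natrM mul2n ler_nat ltnW.
move: bM; rewrite natrM invfM => bM1 hM1.
have b0 : 0 <= b by rewrite /b.
have : h%:R * b <= 2 * M%:R * (8^-1 * M%:R^-1) by rewrite ler_pM.
have -> : 2 * M%:R * (8^-1 * M%:R^-1) = 1 / 4 :> R by field; rewrite gt_eqF.
by [].
Qed.

(** If [r] is the residue of [h a], then [h t] is within [1 / (4 q)] of an integer
    plus [r / q], so [|sin (pi h t)|] is comparable to [r (q - r) / q ^ 2]. *)
Lemma geo_bound_nonresonant h : (h < M.*2)%N -> ~~ (q %| h)%N ->
  geo_bound M (h%:R * t) <= 2 * q%:R * (((h * a) %% q)%N%:R^-1 + (q - (h * a) %% q)%N%:R^-1).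
Proof.
move=> hM qh; set r := ((h * a) %% q)%N.
have r0 : (0 < r)%N by rewrite lt0n -/(dvdn q (h * a)) Gauss_dvdl// coprime_sym.
have rq : (r < q)%N by rewrite ltn_mod.
pose de : R := h%:R * (q%:R * t - a%:R) / q%:R.
have E : h%:R * t = (r%:R / q%:R + de) + ((h * a) %/ q)%N%:~R.
  rewrite -pmulrn /de.
  have : (h%:R * a%:R : R) = ((h * a) %/ q)%N%:R * q%:R + r%:R.
    by rewrite -!natrM -natrD -divn_eq.
  set n := (_ %/ _)%N%:R => hE.
  by apply: (mulfI (lt0r_neq0 q_gt0)); rewrite mulrDr mulrDr mulrA mulrBr hE; field; rewrite gt_eqF.
have r1 : 1 <= r%:R :> R by rewrite ler1n.
have qr1 : 1 <= q%:R - r%:R :> R by rewrite -natrB ?(ltnW rq)// ler1n subn_gt0.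
have hde : `|de| <= (4 * q%:R)^-1.
  rewrite /de !normrM (ger0_norm (ler0n R h)) normfV (gtr0_norm q_gt0) -/b.
  by rewrite invfM ler_pM2r ?invr_gt0// (le_trans (bM' hM))// div1r.
rewrite E geo_bound_shift.
have hq : (4 * q%:R)^-1 * (4 * q%:R) = 1 :> R by rewrite mulVf// mulf_neq0// gt_eqF.
set v := r%:R / q%:R + de.
have vq : v * q%:R = r%:R + de * q%:R by rewrite /v mulrDl divfK ?gt_eqF.
have deq : - (1 / 4) <= de * q%:R <= 1 / 4.
  rewrite -ler_norml normrM (gtr0_norm q_gt0).
  have : `|de| * q%:R <= (4 * q%:R)^-1 * q%:R by rewrite ler_pM2r.
  lra.
have v1 : 3 / 4 * r%:R <= v * q%:R by lra.
have v2 : 3 / 4 * (q%:R - r%:R) <= (1 - v) * q%:R by lra.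
have v0 : 0 <= v <= 1.
  apply/andP; split; first by rewrite -(pmulr_lge0 _ q_gt0); lra.
  by rewrite -subr_ge0 -(pmulr_lge0 _ q_gt0); lra.
have sv := sin_pi_ge v0.
have c0 : 0 < r%:R * (q%:R - r%:R) / (2 * q%:R ^+ 2) :> R.
  by rewrite divr_gt0 ?mulr_gt0 ?exprn_gt0//; lra.
apply: le_trans (geo_bound_inv _ c0 _) _.
  rewrite (le_trans _ (le_trans sv (ler_norm _)))//.
  rewrite ler_pdivrMr ?mulr_gt0 ?exprn_gt0//.
  have : (3 / 4 * r%:R) * (3 / 4 * (q%:R - r%:R)) <= (v * q%:R) * ((1 - v) * q%:R).
    by apply: ler_pM => //; lra.
  have : 0 <= r%:R * (q%:R - r%:R) :> R by rewrite mulr_ge0//; lra.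
  lra.
rewrite natrB ?(ltnW rq)// le_eqVlt; apply/orP; left; apply/eqP; field.
by rewrite !gt_eqF//; lra.
Qed.

(** Up to an integer, [k q t] is [k (q t - a)], of absolute value at most [1 / 4]. *)
Lemma geo_bound_resonant k : (0 < k)%N -> (k * q < M.*2)%N ->
  geo_bound M ((k * q)%:R * t) <= M%:R / Num.max 1 (M%:R * (k%:R * b)).
Proof.
move=> k0 kM.
have E : (k * q)%:R * t = k%:R * (q%:R * t - a%:R) + (k * a)%N%:~R.
  by rewrite -pmulrn !natrM; ring.
rewrite E geo_bound_shift /geo_bound.
rewrite ler_pM2l// lef_pV2 ?posrE ?lt_max ?ltr01//.
rewrite ge_max !le_max lexx/=; apply/orP; right; rewrite ler_pM2l//.
have kb : k%:R * b <= 1 / 4.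
  have := bM' kM; rewrite natrM; apply: le_trans.
  by rewrite ler_wpM2r ?normr_ge0// ler_peMr// ler1n.
have pi2 : 2 <= pi :> R := pi_ge2 R.
set u := k%:R * (q%:R * t - a%:R).
have ub : `|u| = k%:R * b by rewrite normrM (ger0_norm (ler0n _ _)).
have : `|sin (pi * u)| = `|sin (pi * `|u|)|.
  have [u0|u0] := leP 0 u; first by rewrite (ger0_norm u0).
  by rewrite (ltr0_norm u0) mulrN sinN normrN.
move=> ->; rewrite ub (le_trans _ (ler_norm _))//.
have u0 := normr_ge0 u; rewrite ub in u0.
move: u0 kb; set w : R := k%:R * b => u0 kb.
have : (pi * w) / 2 <= sin (pi * w).
  by apply: sin_ge_half; apply/andP; split; nra.
nra.
Qed.

(** [T] is the contribution of the multiples [k q].  Bounding each term by [M] gives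
    the first estimate on [T]; bounding it by the geometric mean
    [sqrt (M / (k b))] of its two bounds [M] and [1 / (k b)] gives the second. *)
Lemma sum_geo_bound_le : exists T : R,
  [/\ \sum_(1 <= h < M.*2) geo_bound M (h%:R * t) <= 40 * M%:R * (1 + ln (8 * M)%:R) + T,
   0 <= T, T * q%:R <= 2 * M%:R ^+ 2 & T ^+ 2 * (b * q%:R) <= 8 * M%:R ^+ 2].
Proof.
pose g (k : nat) : R := if k == 0%N then 0 else M%:R / Num.max 1 (M%:R * (k%:R * b)).
pose f (r : nat) : R := 2 * q%:R * (r%:R^-1 + (q - r)%:R^-1).
pose B := (M.*2 %/ q)%N.
have g0 k : 0 <= g k.
  by rewrite /g; case: eqP => // _; rewrite divr_ge0// le_max ler01.
have f0 r : 0 <= f r by rewrite /f !mulr_ge0// addr_ge0.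
exists (\sum_(1 <= k < B.+1) g k).
have b0 : 0 <= b by rewrite /b.
have Bq : B%:R * q%:R <= 2 * M%:R :> R by rewrite -!natrM ler_nat mul2n leq_trunc_div.
split.
- have -> : \sum_(1 <= k < B.+1) g k = \sum_(0 <= k < B.+1) g k.
    by rewrite [RHS]big_ltn// [g 0%N]/g eqxx add0r.
  have le1 : \sum_(1 <= h < M.*2) geo_bound M (h%:R * t) <=
     \sum_(0 <= h < B.+1 * q) (if (q %| h)%N then g (h %/ q)%N else f ((h * a) %% q)%N).
    have MB : (M.*2 <= B.+1 * q)%N.
      by rewrite ltnW// {1}(divn_eq M.*2 q) mulSn addnC ltn_add2r ltn_mod.
    have MM : (0 < M.*2)%N by rewrite double_gt0.
    rewrite [leRHS](@big_cat_nat _ _ _ M.*2)//= [X in _ <= X + _](@big_ltn _ _ _ 0)//.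
    rewrite (_ : (if (q %| 0)%N then _ else _) = 0); last by rewrite dvdn0 div0n /g eqxx.
    rewrite add0r.
    apply: ler_wpDr.
      by apply: sumr_ge0 => i _; case: ifP.
    apply: ler_sum_nat => h /andP[h1 hM]; case: ifPn => qh.
      have hE : h = (h %/ q * q)%N by rewrite divnK.
      have hq0 : (0 < h %/ q)%N by rewrite divn_gt0// dvdn_leq.
      rewrite {1}hE /g gtn_eqF// ; apply: geo_bound_resonant => //.
      by rewrite -hE.
    exact: geo_bound_nonresonant.
  apply: le_trans le1 _; rewrite sum_blocks// addrC lerD2r.
  have := sum_residues_le q0; rewrite -/f => fs.
  have ln0 : 0 <= ln (8 * M)%:R :> R by rewrite ln_ge0// ler1n muln_gt0.
  have lnq : ln q%:R <= ln (8 * M)%:R :> R.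
    by rewrite ler_ln ?posrE// ?ler_nat// ltr0n muln_gt0.
  have Bq' : B.+1%:R * q%:R <= 10 * M%:R :> R.
    rewrite -natr1 mulrDl mul1r.
    have : q%:R <= 8 * M%:R :> R by rewrite -natrM ler_nat.
    lra.
  apply: le_trans (ler_wpM2l _ fs) _ => //.
  have -> : 40 * M%:R * (1 + ln (8 * M)%:R) = (10 * M%:R) * (4 * (1 + ln (8 * M)%:R)) :> R by ring.
  have -> : B.+1%:R * (4 * q%:R * (1 + ln q%:R)) = (B.+1%:R * q%:R) * (4 * (1 + ln q%:R)) :> R by ring.
  have lnq0 : 0 <= ln q%:R :> R by rewrite ln_ge0// ler1n.
  apply: ler_pM => //; first by rewrite mulr_ge0// addr_ge0.
  by rewrite ler_pM2l// lerD2l.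
- exact: sumr_ge0.
- have : \sum_(1 <= k < B.+1) g k <= B%:R * M%:R.
    apply: le_trans (_ : \sum_(1 <= k < B.+1) M%:R <= _).
      apply: ler_sum_nat => k /andP[k1 _]; rewrite /g gtn_eqF//.
      by rewrite ler_pdivrMr ?lt_max ?ltr01// ler_peMr// le_max lexx.
    by rewrite sumr_const_nat subn1/= mulr_natl.
  move=> h; have : (\sum_(1 <= k < B.+1) g k) * q%:R <= B%:R * M%:R * q%:R by rewrite ler_pM2r.
  move=> /le_trans; apply; rewrite mulrAC expr2 mulrA.
  by rewrite ler_pM2r.
- have [bz|bn0] := eqVneq b 0; first by rewrite bz mul0r mulr0 mulr_ge0.
  have bp : 0 < b by rewrite lt_def bn0.
  have h : \sum_(1 <= k < B.+1) g k <= Num.sqrt (M%:R / b) * (2 * Num.sqrt B%:R).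
    apply: le_trans (_ : \sum_(1 <= k < B.+1) Num.sqrt (M%:R / b) * Num.sqrt k%:R^-1 <= _).
      apply: ler_sum_nat => k /andP[k1 _].
      rewrite -sqrtrM ?divr_ge0// -(ger0_norm (g0 k)) -sqrtr_sqr ler_sqrt ?mulr_ge0 ?invr_ge0 ?divr_ge0//.
      rewrite /g gtn_eqF// expr_div_n ler_pdivrMr ?exprn_gt0 ?lt_max ?ltr01//.
      have kp : 0 < k%:R :> R by rewrite ltr0n.
      have m1 : 1 <= Num.max 1 (M%:R * (k%:R * b)) by rewrite le_max lexx.
      have m2 : M%:R * (k%:R * b) <= Num.max 1 (M%:R * (k%:R * b)) by rewrite le_max lexx orbT.
      set mx := Num.max _ _ in m1 m2 *.
      have mx2 : M%:R * (k%:R * b) <= mx ^+ 2.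
        by apply: le_trans m2 _; rewrite expr2 ler_peMr// (le_trans _ m1).
      apply: le_trans (_ : M%:R / b * k%:R^-1 * (M%:R * (k%:R * b)) <= _).
        by rewrite le_eqVlt; apply/orP; left; apply/eqP; field; rewrite !gt_eqF.
      by rewrite ler_wpM2l// mulr_ge0 ?invr_ge0// divr_ge0.
    rewrite -mulr_sumr ler_wpM2l// sum_inv_sqrt_le//.
  set T := \sum_(_ <= _ < _) _ in h *.
  have T0 : 0 <= T by exact: sumr_ge0.
  have T2 : T ^+ 2 <= 4 * (M%:R / b) * B%:R.
    have -> : 4 * (M%:R / b) * B%:R = (Num.sqrt (M%:R / b) * (2 * Num.sqrt B%:R)) ^+ 2.
      by rewrite !exprMn !sqr_sqrtr ?divr_ge0//; ring.
    by rewrite ler_sqr ?nnegrE// (le_trans T0).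
  apply: le_trans (ler_wpM2r _ T2) _; first by rewrite mulr_ge0.
  have -> : 4 * (M%:R / b) * B%:R * (b * q%:R) = 4 * M%:R * (B%:R * q%:R).
    by field; rewrite gt_eqF.
  have -> : 8 * M%:R ^+ 2 = 4 * M%:R * (2 * M%:R) :> R by ring.
  by rewrite ler_wpM2l// mulr_ge0.
Qed.

End Arc.
End MajorArcs.
(** * The times at which a Weyl sum is large *)

Section Exceptional.
Context {R : realType}.
Implicit Types (t y s theta eta ell eps rho : R) (M : nat).

Let logM M : R := 81 * M%:R * (1 + ln (8 * M)%:R).

(** The logarithmic error takes at most half of [M ^ 2 / rho], so the two estimates
    for the resonant part [T] in [sum_geo_bound_le], together with
    [T > M ^ 2 / (4 rho)], bound [q] and [q |q t - a|]. *)
Lemma weyl_major M (rho y t : R) : (0 < M)%N -> 1 <= rho ->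
  logM M <= M%:R ^+ 2 / (2 * rho) -> M%:R ^+ 2 / rho < weyl2 M y t ->
  exists (q : nat) (a : int), [/\ (0 < q)%N, q%:R <= 8 * rho &
    `|q%:R * t - a%:~R| * q%:R <= 128 * rho ^+ 2 / M%:R ^+ 2].
Proof.
move=> M0 rho1 hlog hw.
have M1 : 1 <= M%:R :> R by rewrite ler1n.
have rho0 : 0 < rho by lra.
(* The precision 1 / (8 M) keeps h |t - a / q| below 1 / (4 q) for all h < 2 M. *)
have [|q [a [c [/andP[q0 qM] aq hb]]]] := @dirichlet R t (8 * M).
  by rewrite muln_gt0.
have [T [hT T0 Tq Tb]] := sum_geo_bound_le M0 q0 aq qM hb.
have wd := weyl_differencing M y (t - c%:~R).
have wE : weyl2 M y (t - c%:~R) = weyl2 M y t.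
  have aux (f : R -> R) : (forall x (k : int), f (x + 2 * pi * k%:~R) = f x) ->
    \sum_(0 <= i < M) f (2 * pi * (i%:R * y + i%:R ^+ 2 * (t - c%:~R))) =
    \sum_(0 <= i < M) f (2 * pi * (i%:R * y + i%:R ^+ 2 * t)).
    move=> hf; apply: eq_bigr => i _; rewrite -(hf _ (i%:Z ^+ 2 * c)%R).
    by congr f; rewrite rmorphM rmorphXn/= -pmulrn; ring.
  rewrite /weyl2 (aux cos); last by apply: periodic_int; exact: cosD2pi.
  by rewrite (aux sin)//; apply: periodic_int; exact: sinD2pi.
have ln0 : 0 <= ln (8 * M)%:R :> R by rewrite ln_ge0// ler1n muln_gt0.
have w2 : weyl2 M y t <= logM M + 2 * T.
  rewrite -wE (le_trans wd)// /logM.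
  have : 0 <= M%:R * ln (8 * M)%:R :> R by rewrite mulr_ge0.
  move: hT M1; set G := \sum_(_ <= _ < _) _; set m : R := M%:R; set l := ln _; lra.
have hrho : M%:R ^+ 2 / (2 * rho) = (M%:R ^+ 2 / rho) / 2 :> R.
  by field; rewrite gt_eqF.
have Tbig : M%:R ^+ 2 < 4 * T * rho.
  have : M%:R ^+ 2 / rho < 4 * T by move: w2 hlog hw; rewrite hrho; lra.
  by rewrite ltr_pdivrMr.
exists q, (a%:Z + q%:Z * c); split => //.
  have Tp : 0 < T by rewrite -(pmulr_lgt0 _ rho0) -(pmulr_rgt0 _ (_ : 0 < 4 :> R))// mulrA (lt_trans _ Tbig)// exprn_gt0//; lra.
  rewrite -(ler_pM2l Tp); lra.
have -> : q%:R * t - (a%:Z + q%:Z * c)%:~R = q%:R * (t - c%:~R) - a%:R.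
  by rewrite intrD intrM -!pmulrn; ring.
set bq := _ * q%:R in Tb *.
have bq0 : 0 <= bq by rewrite mulr_ge0.
have M2 : 0 < M%:R ^+ 2 :> R by rewrite exprn_gt0//; lra.
rewrite ler_pdivlMr//.
have : (M%:R ^+ 2) ^+ 2 * bq <= (4 * T * rho) ^+ 2 * bq.
  by rewrite ler_wpM2r// ler_sqr ?nnegrE ?(ltW M2)// ?ltW// (le_lt_trans _ Tbig).
have -> : (4 * T * rho) ^+ 2 * bq = 16 * rho ^+ 2 * (T ^+ 2 * bq) by ring.
have Tb' : 16 * rho ^+ 2 * (T ^+ 2 * bq) <= 16 * rho ^+ 2 * (8 * M%:R ^+ 2).
  by rewrite ler_wpM2l// mulr_ge0// sqr_ge0.
move=> /le_trans /(_ Tb').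
have -> : 16 * rho ^+ 2 * (8 * M%:R ^+ 2) = M%:R ^+ 2 * (128 * rho ^+ 2) by ring.
by rewrite [(M%:R ^+ 2) ^+ 2]expr2 -mulrA ler_pM2l// mulrC.
Qed.

Lemma one_add_ln_le (x de : R) : 1 <= x -> 0 < de -> 1 + ln (8 * x) <= (1 + ln 8 + de^-1) * x `^ de.
Proof.
move=> x1 de0; have x0 : 0 < x by lra.
have p0 : 0 < x `^ de by exact: powR_gt0.
have p1 : 1 <= x `^ de by rewrite -[leLHS](powRr0 x) ler_powR// ltW.
have l8 : 0 <= ln 8 :> R by rewrite ln_ge0//; lra.
rewrite lnM ?posrE//.
have : ln (x `^ de) <= x `^ de - 1.
  have E : 1 + (x `^ de - 1) = x `^ de by ring.
  rewrite -[in leLHS]E; apply: le_ln1Dx; lra.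
rewrite ln_powR => h.
have h2 : ln x <= de^-1 * x `^ de by rewrite ler_pdivlMl//; lra.
have : (1 + ln 8) * 1 <= (1 + ln 8) * x `^ de by rewrite ler_wpM2l//; lra.
lra.
Qed.

(** The times [s] with [|(q + 1) theta s - n| <= eta / (q + 1)], where the integer
    [n] is shifted by [L (q + 1)] so as to be indexed by the natural number [i]. *)
Definition major_arc (theta eta : R) (L q i : nat) : set R :=
  `[((i%:R - (L * q.+1)%:R) - eta / q.+1%:R) / (q.+1%:R * theta),
    ((i%:R - (L * q.+1)%:R) + eta / q.+1%:R) / (q.+1%:R * theta)]%classic.

Definition major_arcs (theta eta : R) (L Q : nat) : set R :=
  \big[setU/set0]_(q < Q) \big[setU/set0]_(i < (2 * L * q.+1).+1)
    major_arc theta eta L q i.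

Lemma measurable_major_arcs theta eta L Q : measurable (major_arcs theta eta L Q).
Proof. by apply: bigsetU_measurable => q _; apply: bigsetU_measurable => i _; exact: measurable_itv. Qed.

(** There are [O (L q)] arcs with denominator [q], each of length
    [2 eta / (q ^ 2 theta)], whence the harmonic sum. *)
Lemma measure_major_arcs theta eta L Q : 0 < theta -> 0 <= eta -> (0 < L)%N ->
  (lebesgue_measure (major_arcs theta eta L Q) <=
   (6 * L%:R * eta / theta * \sum_(1 <= q < Q.+1) q%:R^-1)%:E)%E.
Proof.
move=> th0 eta0 L0.
apply: (le_trans (@Boole_inequality _ _ _ lebesgue_measure
   (fun q => \big[setU/set0]_(i < (2 * L * q.+1).+1) major_arc theta eta L q i) Q _)).
  by move=> q _; apply: bigsetU_measurable => i _; exact: measurable_itv.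
have arc_le (q : nat) : (lebesgue_measure (\big[setU/set0]_(i < (2 * L * q.+1).+1) major_arc theta eta L q i)
    <= (6 * L%:R * eta / theta * q.+1%:R^-1)%:E)%E.
  have q0 : 0 < q.+1%:R :> R by [].
  have arc1 (i : nat) : (lebesgue_measure (major_arc theta eta L q i) <=
      (2 * eta / (q.+1%:R ^+ 2 * theta))%:E)%E.
    rewrite /major_arc lebesgue_measure_itv/= lte_fin.
    case: ifP => _; last by rewrite lee_fin divr_ge0 ?mulr_ge0//; exact: ltW.
    rewrite -EFinB lee_fin le_eqVlt; apply/orP; left; apply/eqP.
    by field; rewrite !gt_eqF.
  apply: (le_trans (@Boole_inequality _ _ _ lebesgue_measure (major_arc theta eta L q) _ _)).
    by move=> i _; exact: measurable_itv.
  apply: (@le_trans _ _ (\sum_(i < (2 * L * q.+1).+1) (2 * eta / (q.+1%:R ^+ 2 * theta))%:E)%E).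
    by apply: lee_sum => i _; exact: arc1.
  rewrite sumEFin lee_fin sumr_const card_ord -[leLHS]mulr_natl.
  have L1 : 1 <= L%:R :> R by rewrite ler1n.
  have q1 : 1 <= q.+1%:R :> R by rewrite ler1n.
  apply: (@le_trans _ _ ((3 * L%:R * q.+1%:R) * (2 * eta / (q.+1%:R ^+ 2 * theta)))).
    rewrite ler_wpM2r ?divr_ge0 ?mulr_ge0//; first exact: ltW.
    by rewrite -natr1 !natrM; nra.
  by rewrite le_eqVlt; apply/orP; left; apply/eqP; field; rewrite !gt_eqF.
apply: le_trans (lee_sum _ (fun (q : 'I_Q) _ => arc_le q)) _.
by rewrite sumEFin lee_fin -mulr_sumr big_add1/= big_mkord.
Qed.

Lemma mem_major_arcs theta eta (L Q q : nat) (a : int) s : 0 < theta ->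
  (0 < q <= Q)%N -> (`|a| <= L * q)%N -> `|q%:R * (theta * s) - a%:~R| * q%:R <= eta ->
  major_arcs theta eta L Q s.
Proof.
move=> th0; case: q => // q /andP[_ qQ] aL hq.
pose i := absz (a + (L * q.+1)%N%:Z).
have aLq : (0 <= a + (L * q.+1)%N%:Z)%R by lia.
have iE : (i%:R - (L * q.+1)%:R : R) = a%:~R.
  have : (i%:Z = a + (L * q.+1)%N%:Z)%R by rewrite /i gez0_abs.
  move=> /(congr1 (fun z : int => z%:~R : R)); rewrite intrD -!pmulrn => ->.
  by rewrite addrK.
have iL : (i < (2 * L * q.+1).+1)%N by rewrite /i; lia.
apply: (@bigsetU_sup _ q Q
  (fun q => \big[setU/set0]_(i < (2 * L * q.+1).+1) major_arc theta eta L q i)) => //=.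
apply: (@bigsetU_sup _ i _ (major_arc theta eta L q)) => //.
have q0 : 0 < q.+1%:R :> R by [].
rewrite /major_arc/= in_itv/= iE ler_pdivrMr ?mulr_gt0// ler_pdivlMr ?mulr_gt0//.
have : `|q.+1%:R * (theta * s) - a%:~R| <= eta / q.+1%:R by rewrite ler_pdivlMr.
rewrite ler_norml => /andP[h1 h2].
have -> : s * (q.+1%:R * theta) = q.+1%:R * (theta * s) by ring.
move: h1 h2; set v := eta / _; set w := q.+1%:R * _ => h1 h2.
by apply/andP; split; lra.
Qed.

(** If the logarithmic error is harmless at height [M ^ 2 / rho], the exceptional set
    consists of major arcs.  Otherwise [rho] is at least about [M ^ (1 - de)] with
    [(1 - de) (2 + eps) = 2], the right-hand side is bounded below, and the whole
    interval serves as [A]. *)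
Lemma weyl_exceptional theta ell eps : 0 < theta -> 0 <= ell -> 0 < eps ->
  exists C : R, 0 < C /\ forall M rho, (0 < M)%N -> 1 <= rho ->
  exists A : set R, [/\ measurable A,
    (lebesgue_measure A <= (C * rho `^ (2 + eps) / M%:R ^+ 2)%:E)%E &
    forall s y, `|s| <= ell -> ~ A s -> weyl2 M y (theta * s) <= M%:R ^+ 2 / rho].
Proof.
move=> th0 ell0 eps0.
have [L [Lpos LE]] : exists L, (0 < L)%N /\ theta * ell + 1 <= L%:R.
  exists (Num.truncn (theta * ell)).+2; split => //.
  by rewrite -[leRHS]natr1 lerD2r ltW// truncnS_gt.
(* Chosen so that (1 - de) * (2 + eps) = 2. *)
pose de := eps / (2 + eps).
have de0 : 0 < de by rewrite divr_gt0//; lra.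
have l8 : 0 <= ln 8 :> R by rewrite ln_ge0//; lra.
have eI0 : 0 < eps^-1 by rewrite invr_gt0.
have dI0 : 0 < de^-1 by rewrite invr_gt0.
pose Ce := 1 + ln 8 + eps^-1; pose Cd := 1 + ln 8 + de^-1.
have Ce0 : 0 < Ce by rewrite /Ce; lra.
have Cd0 : 0 < Cd by rewrite /Cd; lra.
pose C1 := 768 * L%:R / theta * Ce.
pose C2 := 2 * ell * (162 * Cd) `^ (2 + eps).
have L0 : 0 < L%:R :> R by rewrite ltr0n.
have k768 : 0 < 768 :> R by rewrite ltr0n.
have C10 : 0 < C1 := mulr_gt0 (divr_gt0 (mulr_gt0 k768 L0) th0) Ce0.
have C20 : 0 <= C2 := mulr_ge0 (mulr_ge0 (ler0n _ 2) ell0) (powR_ge0 _ _).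
exists (C1 + C2); split; first lra.
move=> M rho M0 rho1.
have rho0 : 0 < rho by lra.
have M1 : 1 <= M%:R :> R by rewrite ler1n.
have Mgt0 : 0 < M%:R :> R by lra.
have M2 : 0 < M%:R ^+ 2 :> R by rewrite exprn_gt0.
have rp0 : 0 < rho `^ (2 + eps) by exact: powR_gt0.
have [hlog|hlog] := lerP (logM M) (M%:R ^+ 2 / (2 * rho)).
  pose eta := 128 * rho ^+ 2 / M%:R ^+ 2.
  have eta0 : 0 <= eta by rewrite /eta divr_ge0// ?mulr_ge0// ?sqr_ge0// ltW.
  (* Ensures eta <= 1, so that only fractions a / q with |a| <= L q can occur. *)
  have rM : 162 * rho <= M%:R.
    have : 81 * M%:R * (2 * rho) <= M%:R ^+ 2.
      rewrite -ler_pdivlMr ?mulr_gt0//; apply: le_trans hlog; rewrite /logM.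
      by rewrite ler_peMr ?mulr_ge0// lerDl ln_ge0// ler1n muln_gt0.
    have -> : 81 * M%:R * (2 * rho) = M%:R * (162 * rho) by ring.
    by rewrite expr2 ler_pM2l.
  have eta1 : eta <= 1 by rewrite /eta ler_pdivrMr// mul1r; nra.
  have [Q [Q0 Qr QP]] : exists Q, [/\ (0 < Q)%N, Q%:R <= 8 * rho &
      forall q : nat, q%:R <= 8 * rho -> (q <= Q)%N].
    have r8 : 0 <= 8 * rho by lra.
    exists (Num.truncn (8 * rho)); split => [||q hq]; last by rewrite truncn_ge_nat.
      by rewrite truncn_gt0; lra.
    by rewrite truncn_le.
  exists (major_arcs theta eta L Q); split; first exact: measurable_major_arcs.
    apply: le_trans (measure_major_arcs _ th0 eta0 _) _ => //.
    rewrite lee_fin; apply: (@le_trans _ _ (6 * L%:R * eta / theta * (Ce * rho `^ eps))).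
      apply: ler_wpM2l; first exact: (divr_ge0 (mulr_ge0 (mulr_ge0 (ler0n _ 6) (ltW L0)) eta0) (ltW th0)).
            apply: le_trans (harmonic_le Q0) _; apply: (le_trans _ (one_add_ln_le rho1 eps0)).
      by rewrite lerD2l ler_ln ?posrE ?ltr0n//; lra.
    have -> : 6 * L%:R * eta / theta * (Ce * rho `^ eps) =
        C1 * (rho ^+ 2 * rho `^ eps) / M%:R ^+ 2.
      by rewrite /C1 /eta; field; rewrite !gt_eqF.
    rewrite -powR_mulrn ?(ltW rho0)// -powRD; last by rewrite (gt_eqF rho0) implybT.
    by rewrite ler_pM2r ?invr_gt0// ler_pM2r// lerDl.
  move=> s y hs nAs; rewrite leNgt; apply/negP => hw; apply: nAs.
  have [q [a [q0 qr hq]]] := weyl_major M0 rho1 hlog hw.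
  have q1 : 1 <= q%:R :> R by rewrite ler1n.
  apply: (@mem_major_arcs theta eta L Q q a) => //.
    by rewrite q0/= QP.
  rewrite -(ler_nat R) natrM natr_absz.
  have h1 : `|q%:R * (theta * s) - a%:~R| <= 1.
    rewrite -(ler_pM2r (_ : 0 < q%:R)); last by lra.
    by rewrite mul1r (le_trans hq)// (le_trans eta1).
  have h2 : `|q%:R * (theta * s)| <= q%:R * (theta * ell).
    rewrite normrM (ger0_norm (ler0n _ _)) ler_wpM2l//.
    by rewrite normrM (gtr0_norm th0) ler_pM2l.
  have -> : `|a|%:~R = `|a%:~R| :> R by rewrite intr_norm.
  have := ler_normB (q%:R * (theta * s)) (q%:R * (theta * s) - a%:~R).
  rewrite subKr => h3.
  have : q%:R * (theta * ell + 1) <= q%:R * L%:R by rewrite ler_wpM2l.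
  by rewrite [q%:R * L%:R]mulrC; lra.
exists `[- ell, ell]%classic; split; first exact: measurable_itv.
  rewrite lebesgue_measure_itv/= lte_fin; case: ifP => _; last first.
    by rewrite lee_fin divr_ge0 ?mulr_ge0 ?addr_ge0 ?(ltW C10)// ltW.
  rewrite -EFinD lee_fin ler_pdivlMr//.
  have hM : M%:R `^ (1 - de) <= 162 * Cd * rho.
    have k1 : M%:R * M%:R < (162 * Cd * rho) * (M%:R * M%:R `^ de).
      have : M%:R ^+ 2 < logM M * (2 * rho) by rewrite -ltr_pdivrMr// mulr_gt0.
      rewrite expr2 => /lt_le_trans; apply.
      have -> : 162 * Cd * rho * (M%:R * M%:R `^ de) =
        81 * M%:R * (Cd * M%:R `^ de) * (2 * rho) by ring.
      rewrite ler_pM2r ?mulr_gt0// /logM natrM ler_pM2l ?mulr_gt0//.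
      exact: one_add_ln_le.
    have pd : 0 < M%:R `^ de :> R by exact: powR_gt0.
    rewrite powRB; last by rewrite (gt_eqF Mgt0) implybT.
    rewrite powRr1 ?(ltW Mgt0)// ler_pdivrMr//.
    move: k1; rewrite mulrCA ltr_pM2l// => /ltW.
    by [].
  have hM2 : M%:R ^+ 2 <= (162 * Cd) `^ (2 + eps) * rho `^ (2 + eps).
    rewrite -powRM ?mulr_ge0 ?(ltW Cd0) ?(ltW rho0)//.
    have -> : M%:R ^+ 2 = (M%:R `^ (1 - de)) `^ (2 + eps).
      rewrite -powRrM -powR_mulrn ?(ltW Mgt0)//; congr powR.
      by rewrite /de; field; rewrite gt_eqF//; lra.
    rewrite ge0_ler_powR ?nnegrE ?powR_ge0//; first lra.
    by rewrite !mulr_ge0 ?(ltW Cd0) ?(ltW rho0).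
  have e1 : (ell - - ell) * M%:R ^+ 2 <= C2 * rho `^ (2 + eps).
    have -> : (ell - - ell) * M%:R ^+ 2 = 2 * ell * M%:R ^+ 2 by ring.
    rewrite /C2 -[leRHS]mulrA; apply: ler_wpM2l => //.
    exact: mulr_ge0.
  by rewrite [leRHS]mulrDl (le_trans e1)// lerDr mulr_ge0// ltW.
by move=> s y hs; rewrite /= in_itv/= -ler_norml hs.
Qed.

End Exceptional.
(** * Orthonormal systems and Bessel's inequality *)

Section FiniteCauchySchwarz.
Context {R : realType} {I : finType}.

(** [D (D A - B ^ 2)] is the sum of the squares [(D c_i - B d_i) ^ 2]. *)
Lemma cauchy_schwarz_sum (c d : I -> R) :
  (\sum_i c i * d i) ^+ 2 <= (\sum_i c i ^+ 2) * (\sum_i d i ^+ 2).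
Proof.
set A := \sum_i c i ^+ 2; set B := \sum_i c i * d i; set D := \sum_i d i ^+ 2.
have D0 : 0 <= D by apply: sumr_ge0 => i _; exact: sqr_ge0.
have key : 0 <= D * (D * A - B ^+ 2).
  have -> : D * (D * A - B ^+ 2) = \sum_i (D * c i - B * d i) ^+ 2.
    have e i : (D * c i - B * d i) ^+ 2 =
        D ^+ 2 * c i ^+ 2 - 2 * D * B * (c i * d i) + B ^+ 2 * d i ^+ 2 by ring.
    rewrite (eq_bigr _ (fun i _ => e i)) big_split sumrB/= -!mulr_sumr.
    by rewrite -/A -/B -/D; ring.
  by apply: sumr_ge0 => i _; exact: sqr_ge0.
have [Dz|Dn] := eqVneq D 0.
  have d0 i : d i = 0.
    apply/eqP; rewrite -sqrf_eq0; apply/eqP.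
    by apply: (psumr_eq0P _ Dz) => // j _; exact: sqr_ge0.
  rewrite Dz mulr0 /B big1 ?expr0n// => i _; by rewrite d0 mulr0.
have Dp : 0 < D by rewrite lt_def Dn.
by move: key; rewrite pmulr_rge0// subr_ge0 mulrC.
Qed.

End FiniteCauchySchwarz.

Section RintegralSum.
Context d {T : measurableType d} {R : realType} (mu : {measure set T -> \bar R}).

Lemma integrable_sumR (I : Type) (s : seq I) (f : I -> T -> R) :
  (forall i, mu.-integrable setT (EFin \o f i)) ->
  mu.-integrable setT (EFin \o (fun x => \sum_(i <- s) f i x)).
Proof.
move=> fi; rewrite (_ : _ \o _ = fun x => (\sum_(i <- s) (EFin \o f i) x)%E).
  by apply: integrable_sum => // i _; exact: fi.
by apply/funext => x; rewrite /= sumEFin.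
Qed.

Lemma integrableZR (k : R) (f : T -> R) : mu.-integrable setT (EFin \o f) ->
  mu.-integrable setT (EFin \o (fun x => k * f x)).
Proof.
move=> fi; rewrite (_ : _ \o _ = fun x => (k%:E * (EFin \o f) x)%E)//.
exact: integrableZl.
Qed.

Lemma integrableDR (f g : T -> R) : mu.-integrable setT (EFin \o f) ->
  mu.-integrable setT (EFin \o g) -> mu.-integrable setT (EFin \o (fun x => f x + g x)).
Proof.
move=> fi gi; rewrite (_ : _ \o _ = (EFin \o f) \+ (EFin \o g))%E//.
exact: integrableD.
Qed.

Lemma Rintegral_sum (I : Type) (s : seq I) (f : I -> T -> R) :
  (forall i, mu.-integrable setT (EFin \o f i)) ->
  \int[mu]_x (\sum_(i <- s) f i x) = \sum_(i <- s) \int[mu]_x f i x.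
Proof.
move=> fi; elim: s => [|i s IH].
  by under eq_Rintegral do rewrite big_nil; rewrite big_nil Rintegral_cst// mul0r.
under eq_Rintegral do rewrite big_cons.
by rewrite RintegralD// ?IH ?big_cons//; exact: integrable_sumR.
Qed.

End RintegralSum.

Section SquareIntegrable.
Context d {T : measurableType d} {R : realType} (mu : {measure set T -> \bar R}).
Implicit Types g h : T -> R.

(** Membership in [L ^ 2] in the form used here: products of two such functions are
    integrable. *)
Definition sqi g := measurable_fun setT g /\
  mu.-integrable setT (EFin \o (fun x => g x ^+ 2)).

Lemma sqiM g h : sqi g -> sqi h -> mu.-integrable setT (EFin \o (fun x => g x * h x)).
Proof.
move=> [mg ig] [mh ih].
apply: (@le_integrable _ _ _ mu _ measurableT _
   (EFin \o (fun x => g x ^+ 2 + h x ^+ 2))).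
- by apply/measurable_EFinP; exact: measurable_funM.
- move=> x _; rewrite /= lee_fin normrM.
  rewrite (@ger0_norm _ (_ + _)) ?addr_ge0 ?sqr_ge0//.
  rewrite -(real_normK (num_real (g x))) -(real_normK (num_real (h x))).
  have := sqr_ge0 (`|g x| - `|h x|); rewrite sqrrB mulr2n.
  have : 0 <= `|g x| * `|h x| by rewrite mulr_ge0.
  lra.
- exact: integrableDR.
Qed.

Lemma sqiZ (k : R) g : sqi g -> sqi (fun x => k * g x).
Proof.
move=> [mg ig]; split; first by apply: measurable_funM.
under [X in EFin \o X]eq_fun do rewrite exprMn.
exact: integrableZR.
Qed.

Lemma sqiD g h : sqi g -> sqi h -> sqi (fun x => g x + h x).
Proof.
move=> sg sh; have [mg ig] := sg; have [mh ih] := sh.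
split; first exact: measurable_funD.
have -> : (fun x => (g x + h x) ^+ 2) =
    (fun x => (g x ^+ 2 + h x ^+ 2) + 2 * (g x * h x)).
  by apply/funext => x; ring.
apply: integrableDR; first exact: integrableDR.
by apply: integrableZR; exact: sqiM.
Qed.

Lemma sqi0 : sqi (fun=> 0).
Proof.
split => //; rewrite (_ : _ \o _ = cst 0%E); first exact: integrable0.
by apply/funext => x; rewrite /= expr0n.
Qed.

Lemma sqi_sum (I : Type) (s : seq I) (f : I -> T -> R) : (forall i, sqi (f i)) ->
  sqi (fun x => \sum_(i <- s) f i x).
Proof.
move=> sf; elim: s => [|i s IH].
  by under eq_fun do rewrite big_nil; exact: sqi0.
by under eq_fun do rewrite big_cons; exact: sqiD.
Qed.

(** An orthonormal system of plane vector fields [(p i, q i)]. *)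
Section Bessel.
Context {I : finType} (p q : I -> T -> R).
Hypotheses (sp : forall i, sqi (p i)) (sq : forall i, sqi (q i)).
Hypothesis orth : forall i k, \int[mu]_x (p i x * p k x + q i x * q k x) = (i == k)%:R.

Let ppi i k : mu.-integrable setT (EFin \o (fun x => p i x * p k x + q i x * q k x)).
Proof. by apply: integrableDR; apply: sqiM. Qed.

Lemma parseval (c : I -> R) :
  \int[mu]_x ((\sum_i c i * p i x) ^+ 2 + (\sum_i c i * q i x) ^+ 2) = \sum_i c i ^+ 2.
Proof.
transitivity (\int[mu]_x (\sum_i \sum_k
   (c i * c k) * (p i x * p k x + q i x * q k x))).
  apply: eq_Rintegral => x _; rewrite !expr2 !big_distrlr/= -big_split/=.
  apply: eq_bigr => i _; rewrite -big_split/=; apply: eq_bigr => k _; ring.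
rewrite Rintegral_sum; last first.
  by move=> i; apply: integrable_sumR => k; exact: integrableZR.
apply: eq_bigr => i _; rewrite Rintegral_sum; last by move=> k; exact: integrableZR.
under eq_bigr do rewrite RintegralZl// orth.
by rewrite (bigD1 i)//= eqxx mulr1 big1 ?addr0// => k /negPf; rewrite eq_sym => ->; rewrite mulr0.
Qed.

(** With [V] the projection of [(g, h)] on the system, integrate
    [2 ((g, h) . V) <= |(g, h)| ^ 2 + |V| ^ 2]. *)
Lemma bessel g h : sqi g -> sqi h ->
  \sum_i (\int[mu]_x (g x * p i x + h x * q i x)) ^+ 2 <= \int[mu]_x (g x ^+ 2 + h x ^+ 2).
Proof.
move=> sg sh.
pose c i := \int[mu]_x (g x * p i x + h x * q i x).
pose V1 x := \sum_i c i * p i x; pose V2 x := \sum_i c i * q i x.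
have sV1 : sqi V1 by apply: sqi_sum => i; exact: sqiZ.
have sV2 : sqi V2 by apply: sqi_sum => i; exact: sqiZ.
have gpi i : mu.-integrable setT (EFin \o (fun x => g x * p i x + h x * q i x)).
  by apply: integrableDR; apply: sqiM.
have e1 : \int[mu]_x (g x * V1 x + h x * V2 x) = \sum_i c i ^+ 2.
  transitivity (\int[mu]_x (\sum_i c i * (g x * p i x + h x * q i x))).
    apply: eq_Rintegral => x _; rewrite /V1 /V2 !mulr_sumr -big_split/=.
    by apply: eq_bigr => i _; ring.
  rewrite Rintegral_sum; last by move=> i; exact: integrableZR.
  by apply: eq_bigr => i _; rewrite RintegralZl.
have e2 := parseval c; rewrite -/(V1 _) -/(V2 _) in e2.
have : \int[mu]_x (2 * (g x * V1 x + h x * V2 x)) <=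
   \int[mu]_x ((g x ^+ 2 + h x ^+ 2) + (V1 x ^+ 2 + V2 x ^+ 2)).
  apply: le_Rintegral => //.
  - by apply: integrableZR; apply: integrableDR; exact: sqiM.
  - by apply: integrableDR; apply: integrableDR; [exact: sg.2|exact: sh.2|exact: sV1.2|exact: sV2.2].
  - move=> x _; have := sqr_ge0 (g x - V1 x); have := sqr_ge0 (h x - V2 x).
    rewrite !sqrrB !mulr2n; lra.
have -> : \int[mu]_x (2 * (g x * V1 x + h x * V2 x)) = 2 * \sum_i c i ^+ 2.
  by rewrite RintegralZl ?e1//; apply: integrableDR; exact: sqiM.
have -> : \int[mu]_x ((g x ^+ 2 + h x ^+ 2) + (V1 x ^+ 2 + V2 x ^+ 2)) =
    \int[mu]_x (g x ^+ 2 + h x ^+ 2) + \sum_i c i ^+ 2.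
  rewrite [LHS]RintegralD ?e2//.
  - by apply: integrableDR; [exact: sg.2|exact: sh.2].
  - by apply: integrableDR; [exact: sV1.2|exact: sV2.2].
rewrite -/(c _); lra.
Qed.

End Bessel.
End SquareIntegrable.
(** * Bounded functions on products and their slices *)

Section BoundedSupport.
Context d {T : measurableType d} {R : realType} (mu : {measure set T -> \bar R}).
Variable D : set T.
Hypotheses (mD : measurable D) (fD : (mu D < +oo)%E).
Implicit Types w v : T -> R.

(** Bounded measurable functions vanishing off [D].  Every section of such a function
    on a product is again of this kind, so that iterated integrals make sense at
    every point and not only almost everywhere. *)
Definition bsupp w := measurable_fun setT w /\
  exists B : R, 0 <= B /\ forall x, `|w x| <= B * \1_D x.

Lemma integral_indic_fin A : measurable A -> \int[mu]_x (\1_A x : R) = fine (mu A).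
Proof. by move=> mA; rewrite /Rintegral integral_indic// setIT. Qed.

Lemma integrable_indic_fin A : measurable A -> (mu A < +oo)%E ->
  mu.-integrable setT (EFin \o (\1_A : T -> R)).
Proof.
move=> mA fA; apply/integrableP; split; first exact/measurable_EFinP.
under eq_integral do rewrite /= ger0_norm//.
by rewrite integral_indic// setIT.
Qed.

Lemma bsupp_integrable w : bsupp w -> mu.-integrable setT (EFin \o w).
Proof.
move=> [mw [B [B0 wB]]].
apply: (@le_integrable _ _ _ mu _ measurableT _ (EFin \o (fun x => B * \1_D x))).
- exact/measurable_EFinP.
- move=> x _; by rewrite /= lee_fin (le_trans (wB x))// ler_norm.
- by apply: integrableZR; exact: integrable_indic_fin.
Qed.

Lemma bsuppM w v (B : R) : bsupp w -> measurable_fun setT v -> 0 <= B ->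
  (forall x, D x -> `|v x| <= B) -> bsupp (fun x => w x * v x).
Proof.
move=> [mw [C [C0 wC]]] mv B0 vB; split; first exact: measurable_funM.
exists (C * B); split; first exact: mulr_ge0.
move=> x; rewrite normrM; have := wC x; rewrite indicE.
case: (boolP (x \in D)) => [/set_mem xD|_]; rewrite ?mulr1 ?mulr0 => wx.
  by rewrite ler_pM// vB.
have -> : w x = 0 by apply/eqP; rewrite -normr_le0.
by rewrite normr0 mul0r.
Qed.

Lemma bsupp_bound w : bsupp w -> exists B, 0 <= B /\ forall x, D x -> `|w x| <= B.
Proof.
move=> [_ [B [B0 wB]]]; exists B; split => // x xD.
by rewrite (le_trans (wB x))// indicE mem_set// mulr1.
Qed.

Lemma bsupp_out w x : bsupp w -> ~ D x -> w x = 0.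
Proof.
move=> [_ [B [B0 wB]]] xD; apply/eqP; rewrite -normr_le0 (le_trans (wB x))//.
by rewrite indicE memNset// mulr0.
Qed.

Lemma bsupp_sqi w : bsupp w -> sqi mu w.
Proof.
move=> bw; split; first exact: bw.1.
apply: bsupp_integrable; have [B [B0 wB]] := bsupp_bound bw.
exact: (bsuppM bw bw.1 B0 wB).
Qed.

Lemma bsupp_indic v (B : R) : measurable_fun setT v -> 0 <= B ->
  (forall x, D x -> `|v x| <= B) -> bsupp (fun x => \1_D x * v x).
Proof.
move=> mv B0 vB; apply: bsuppM vB => //; split => //.
by exists 1; split => // x; rewrite mul1r ger0_norm.
Qed.

End BoundedSupport.

Section Slices.
Context d1 d2 {T1 : measurableType d1} {T2 : measurableType d2} {R : realType}.
Context (m1 : {sigma_finite_measure set T1 -> \bar R}).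
Context (m2 : {sigma_finite_measure set T2 -> \bar R}).
Variables (D1 : set T1) (D2 : set T2).
Hypotheses (mD1 : measurable D1) (fD1 : (m1 D1 < +oo)%E).
Hypotheses (mD2 : measurable D2) (fD2 : (m2 D2 < +oo)%E).

Let mD : measurable (D1 `*` D2). Proof. exact: measurableX. Qed.

Let fD : ((m1 \x m2) (D1 `*` D2) < +oo)%E.
Proof. by rewrite product_measure1E// lte_mul_pinfty// ge0_fin_numE. Qed.

Lemma bsupp_section w t : bsupp (D1 `*` D2) w -> bsupp D2 (fun y => w (t, y) : R).
Proof.
move=> [mw [B [B0 wB]]]; split; first exact: measurableT_comp.
exists B; split => // y; rewrite (le_trans (wB _))// ler_wpM2l// !indicE in_setX/=.
by case: (_ \in _); case: (_ \in _).
Qed.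

Lemma bsupp_section2 w y : bsupp (D1 `*` D2) w -> bsupp D1 (fun t => w (t, y) : R).
Proof.
move=> [mw [B [B0 wB]]]; split; first exact: measurableT_comp.
exists B; split => // t; rewrite (le_trans (wB _))// ler_wpM2l// !indicE in_setX/=.
by case: (_ \in _); case: (_ \in _).
Qed.

Definition slice (w : T1 * T2 -> R) t : R := \int[m2]_y w (t, y).

Lemma EFin_slice w t : bsupp (D1 `*` D2) w -> (slice w t)%:E = (\int[m2]_y (w (t, y))%:E)%E.
Proof.
move=> bw; rewrite /slice /Rintegral fineK//.
by apply: integrable_fin_num => //; apply: bsupp_integrable fD2 _ (bsupp_section t bw).
Qed.

Lemma bsupp_slice w : bsupp (D1 `*` D2) w -> bsupp D1 (slice w).
Proof.
move=> bw; split.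
  apply/measurable_EFinP.
  rewrite (_ : _ \o _ = fubini_F m2 (EFin \o w)); last first.
    by apply/funext => t; rewrite /= (EFin_slice _ bw).
  apply: (@measurable_fubini_F _ _ _ _ _ m1 m2).
  exact: bsupp_integrable fD _ bw.
have [mw [B [B0 wB]]] := bw.
exists (B * fine (m2 D2)); split; first by rewrite mulr_ge0// fine_ge0.
move=> t; have bs := bsupp_section t bw.
have ibs := bsupp_integrable mD2 fD2 bs.
apply: le_trans (le_normr_Rintegral measurableT ibs) _.
apply: (@le_trans _ _ (\int[m2]_y ((B * \1_D1 t) * \1_D2 y))).
  apply: le_Rintegral => //.
  - exact: integrable_norm.
  - by apply: integrableZR; exact: integrable_indic_fin.
  - move=> y _; rewrite (le_trans (wB _))// -mulrA ler_wpM2l// !indicE in_setX/=.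
    by case: (_ \in _); case: (_ \in _); rewrite ?mulr1 ?mulr0.
rewrite RintegralZl//; last exact: integrable_indic_fin.
by rewrite integral_indic_fin// mulrAC.
Qed.

Lemma Rintegral_slice w : bsupp (D1 `*` D2) w ->
  \int[m1]_t slice w t = \int[(m1 \x m2)%E]_z w z.
Proof.
move=> bw; rewrite /Rintegral.
rewrite -(@integral12_prod_meas1 _ _ _ _ _ m1 m2 (EFin \o w)); last first.
  exact: bsupp_integrable fD _ bw.
by congr fine; apply: eq_integral => t _; rewrite (EFin_slice _ bw).
Qed.

Lemma bsupp_slice2 w : bsupp (D1 `*` D2) w ->
  bsupp D2 (fun y => \int[m1]_t w (t, y) : R).
Proof.
move=> bw.
have intw y := bsupp_integrable mD1 fD1 (bsupp_section2 y bw).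
split.
  apply/measurable_EFinP.
  rewrite (_ : _ \o _ = fubini_G m1 (EFin \o w)); last first.
    apply/funext => y; rewrite /= /Rintegral fineK//.
    by apply: integrable_fin_num => //; exact: intw.
  apply: (@measurable_fubini_G _ _ _ _ _ m1 m2).
  exact: bsupp_integrable fD _ bw.
have [mw [B [B0 wB]]] := bw.
exists (B * fine (m1 D1)); split; first by rewrite mulr_ge0// fine_ge0.
move=> y; apply: le_trans (le_normr_Rintegral measurableT (intw y)) _.
apply: (@le_trans _ _ (\int[m1]_t ((B * \1_D2 y) * \1_D1 t))).
  apply: le_Rintegral => //.
  - by apply: integrable_norm; exact: intw.
  - by apply: integrableZR; exact: integrable_indic_fin.
  - move=> t _; rewrite (le_trans (wB _))// -mulrA ler_wpM2l// !indicE in_setX/=.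
    by case: (_ \in _); case: (_ \in _); rewrite ?mulr1 ?mulr0.
rewrite RintegralZl//; last exact: integrable_indic_fin.
by rewrite integral_indic_fin// mulrAC.
Qed.

Lemma Rintegral_slice2 w : bsupp (D1 `*` D2) w ->
  \int[m2]_y \int[m1]_t w (t, y) = \int[(m1 \x m2)%E]_z w z.
Proof.
move=> bw; rewrite /Rintegral.
rewrite -(@integral21_prod_meas1 _ _ _ _ _ m1 m2 (EFin \o w)); last first.
  exact: bsupp_integrable fD _ bw.
congr fine; apply: eq_integral => y _; rewrite fineK//.
by apply: integrable_fin_num => //; apply: bsupp_integrable fD1 _ (bsupp_section2 y bw).
Qed.

End Slices.
(** * The TT* inequality over pairs of times *)

Section TTstar.
Context d1 d2 {T1 : measurableType d1} {T2 : measurableType d2} {R : realType}.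
Context (m1 : {sigma_finite_measure set T1 -> \bar R}).
Context (m2 : {sigma_finite_measure set T2 -> \bar R}).
Variables (D1 : set T1) (D2 : set T2).
Hypotheses (mD1 : measurable D1) (fD1 : (m1 D1 < +oo)%E).
Hypotheses (mD2 : measurable D2) (fD2 : (m2 D2 < +oo)%E).
Context {I : finType}.
Variables (u : I -> T1 * T2 -> R) (m l : T1 * T2 -> R).
Hypotheses (bu : forall i, bsupp (D1 `*` D2) (u i)).
Hypotheses (bm : bsupp (D1 `*` D2) m) (bl : bsupp (D1 `*` D2) l).
Hypotheses (m0 : forall z, 0 <= m z) (l0 : forall z, 0 <= l z).
Variables (Rel : set (T1 * T1)) (alpha tau : R).
Hypotheses (mRel : measurable Rel) (tau0 : 0 <= tau).
Hypothesis Rel1 : forall t, (m1 [set t' | Rel (t, t')] <= alpha%:E)%E.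
Hypothesis Rel2 : forall t', (m1 [set t | Rel (t, t')] <= alpha%:E)%E.
Hypothesis near : forall t, \sum_i (slice m2 (u i) t) ^+ 2 <= slice m2 m t.
Hypothesis far : forall t t' y y', ~ Rel (t, t') ->
  \sum_i u i (t, y) * u i (t', y') <= tau * (l (t, y) * l (t', y')).

Let Du i := slice m2 (u i).
Let mm := slice m2 m.
Let ll := slice m2 l.
Let bDu i : bsupp D1 (Du i). Proof. exact: (bsupp_slice mD1 fD1 mD2 fD2). Qed.
Let bmm : bsupp D1 mm. Proof. exact: (bsupp_slice mD1 fD1 mD2 fD2). Qed.
Let bll : bsupp D1 ll. Proof. exact: (bsupp_slice mD1 fD1 mD2 fD2). Qed.
Let mm0 t : 0 <= mm t. Proof. by apply: Rintegral_ge0 => y _. Qed.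
Let ll0 t : 0 <= ll t. Proof. by apply: Rintegral_ge0 => y _. Qed.

Let intD1 w : bsupp D1 w -> m1.-integrable setT (EFin \o w).
Proof. exact: bsupp_integrable. Qed.
Let intD2 w : bsupp D2 w -> m2.-integrable setT (EFin \o w).
Proof. exact: bsupp_integrable. Qed.
Let bsec (w : T1 * T2 -> R) t : bsupp (D1 `*` D2) w -> bsupp D2 (fun y => w (t, y)).
Proof. exact: bsupp_section. Qed.

(** The pointwise kernel bound, integrated over both space variables. *)
Lemma far_slices t t' : ~ Rel (t, t') ->
  \sum_i Du i t * Du i t' <= tau * (ll t * ll t').
Proof.
move=> nR.
have step (y : T2) : \sum_i u i (t, y) * Du i t' <= tau * (l (t, y) * ll t').
  have -> : \sum_i u i (t, y) * Du i t' = \int[m2]_y' (\sum_i u i (t, y) * u i (t', y')).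
    rewrite Rintegral_sum; last first.
      by move=> i; apply: integrableZR; apply: intD2; exact: bsec.
    apply: eq_bigr => i _; rewrite RintegralZl//; apply: intD2; exact: bsec.
  have -> : tau * (l (t, y) * ll t') = \int[m2]_y' ((tau * l (t, y)) * l (t', y')).
    by rewrite RintegralZl ?mulrA//; apply: intD2; exact: bsec.
  apply: le_Rintegral => //.
  - by apply: integrable_sumR => i; apply: integrableZR; apply: intD2; exact: bsec.
  - by apply: integrableZR; apply: intD2; exact: bsec.
  - by move=> y' _; rewrite -mulrA; exact: far.
have -> : \sum_i Du i t * Du i t' = \int[m2]_y (\sum_i Du i t' * u i (t, y)).
  rewrite Rintegral_sum; last first.
    by move=> i; apply: integrableZR; apply: intD2; exact: bsec.
  by apply: eq_bigr => i _; rewrite RintegralZl 1?mulrC//; apply: intD2; exact: bsec.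
have -> : tau * (ll t * ll t') = \int[m2]_y ((tau * ll t') * l (t, y)).
  rewrite RintegralZl//; last by apply: intD2; exact: bsec.
  have -> : \int[m2]_y l (t, y) = ll t by [].
  by ring.
apply: le_Rintegral => //.
- by apply: integrable_sumR => i; apply: integrableZR; apply: intD2; exact: bsec.
- by apply: integrableZR; apply: intD2; exact: bsec.
- move=> y _; under eq_bigr do rewrite mulrC.
  by rewrite (le_trans (step y))// le_eqVlt; apply/orP; left; apply/eqP; ring.
Qed.

Let ker (z : T1 * T1) : R := \1_D1 z.1 * (\1_Rel z * mm z.2).

Let bker : bsupp (D1 `*` D1) ker.
Proof.
have [B [B0 mB]] := bsupp_bound bmm.
split.
  apply: measurable_funM; first by apply: measurableT_comp.
  by apply: measurable_funM => //; apply: measurableT_comp => //; exact: bmm.1.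
exists B; split => // -[t t']; rewrite /ker/= !indicE in_setX/=.
case: (t \in D1) => /=; rewrite ?mul1r ?mul0r ?normr0 ?mulr0//.
have [t'D|t'D] := pselect (D1 t').
  rewrite (mem_set t'D) mulr1 normrM.
  by case: (_ \in Rel); rewrite ?normr1 ?normr0 ?mul1r ?mul0r// mB.
by rewrite (bsupp_out bmm t'D) mulr0 normr0 mulr_ge0.
Qed.

Let mRel1 t : measurable [set t' | Rel (t, t')].
Proof. by rewrite -[X in measurable X]setTI; exact: (pair1_measurable t). Qed.
Let mRel2 t' : measurable [set t | Rel (t, t')].
Proof. by rewrite -[X in measurable X]setTI; exact: (pair2_measurable t'). Qed.

Let fRel1 t : (m1 [set t' | Rel (t, t')] < +oo)%E.
Proof. by rewrite (le_lt_trans (Rel1 t))// ltry. Qed.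
Let fRel2 t' : (m1 [set t | Rel (t, t')] < +oo)%E.
Proof. by rewrite (le_lt_trans (Rel2 t'))// ltry. Qed.

Let fine_le_alpha A : (m1 A <= alpha%:E)%E -> fine (m1 A) <= alpha.
Proof.
move=> h; rewrite -lee_fin fineK// ge0_fin_numE//.
by rewrite (le_lt_trans h)// ltry.
Qed.

Let indic_section t t' : \1_[set t' | Rel (t, t')] t' = \1_Rel (t, t') :> R.
Proof. by rewrite !indicE; congr (_%:R); apply/idP/idP => /set_mem h; exact/mem_set. Qed.
Let indic_section2 t t' : \1_[set t | Rel (t, t')] t = \1_Rel (t, t') :> R.
Proof. by rewrite !indicE; congr (_%:R); apply/idP/idP => /set_mem h; exact/mem_set. Qed.

(** Tonelli: for fixed [t'] the relation holds on a set of times of measure at most [alpha]. *)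
Let int_ker : \int[m1]_t slice m1 ker t <= alpha * \int[m1]_t mm t.
Proof.
rewrite (Rintegral_slice mD1 fD1 mD1 fD1 bker) -(Rintegral_slice2 mD1 fD1 mD1 fD1 bker).
rewrite -RintegralZl//; last exact: intD1.
apply: le_Rintegral => //.
- apply: intD1; exact: (bsupp_slice2 mD1 fD1 mD1 fD1 bker).
- by apply: integrableZR; exact: intD1.
- move=> t' _; apply: (@le_trans _ _ (\int[m1]_t (mm t' * \1_[set t | Rel (t, t')] t))).
    apply: le_Rintegral => //.
    + exact: bsupp_integrable fD1 _ (bsupp_section2 t' bker).
    + by apply: integrableZR; exact: (integrable_indic_fin (mRel2 t') (fRel2 t')).
    + move=> t _; rewrite /ker/= indic_section2 [leRHS]mulrC.
      apply: ler_piMl; first exact: mulr_ge0.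
      by rewrite indicE; case: (_ \in _); rewrite ?lexx ?ler01.
  rewrite RintegralZl//; last exact: (integrable_indic_fin (mRel2 t') (fRel2 t')).
  rewrite integral_indic_fin// mulrC ler_wpM2r//; exact: fine_le_alpha.
Qed.

(** With [D_i] the slices of [u i], the left-hand side is the double integral of
    [sum_i D_i t * D_i t'].  Where [Rel] holds the integrand is at most half the sum
    of [sum_i D_i t ^ 2] and [sum_i D_i t' ^ 2], which [near] controls; elsewhere
    [far] applies. *)
Lemma TTstar_bound :
  \sum_i (\int[(m1 \x m2)%E]_z u i z) ^+ 2 <=
  alpha * \int[(m1 \x m2)%E]_z m z + tau * (\int[(m1 \x m2)%E]_z l z) ^+ 2.
Proof.
rewrite -(Rintegral_slice mD1 fD1 mD2 fD2 bm) -(Rintegral_slice mD1 fD1 mD2 fD2 bl).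
rewrite -/mm -/ll; set L := \int[m1]_t ll t; set X := \int[m1]_t mm t.
pose c i := \int[m1]_t Du i t.
have -> : \sum_i (\int[(m1 \x m2)%E]_z u i z) ^+ 2 = \int[m1]_t (\sum_i c i * Du i t).
  rewrite Rintegral_sum; last by move=> i; apply: integrableZR; exact: intD1.
  apply: eq_bigr => i _; rewrite RintegralZl//; last exact: intD1.
  by rewrite -/(c i) -expr2 /c (Rintegral_slice mD1 fD1 mD2 fD2).
have bsk := bsupp_slice mD1 fD1 mD1 fD1 bker.
have pt t : \sum_i c i * Du i t <=
    (alpha / 2) * mm t + (2^-1 * slice m1 ker t + (tau * L) * ll t).
  have [tD|tD] := pselect (D1 t); last first.
    rewrite big1; last by move=> i _; rewrite (bsupp_out (bDu i) tD) mulr0.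
    rewrite (bsupp_out bmm tD) (bsupp_out bll tD) (bsupp_out bsk tD).
    by rewrite !mulr0 !addr0.
  have -> : \sum_i c i * Du i t = \int[m1]_t' (\sum_i Du i t * Du i t').
    rewrite Rintegral_sum; last by move=> i; apply: integrableZR; exact: intD1.
    by apply: eq_bigr => i _; rewrite RintegralZl 1?mulrC//; exact: intD1.
  have iR := integrable_indic_fin (mRel1 t) (fRel1 t).
  have iker : m1.-integrable setT (EFin \o (fun t' => ker (t, t'))).
    exact: bsupp_integrable fD1 _ (bsupp_section t bker).
  apply: (@le_trans _ _ (\int[m1]_t' ((mm t / 2) * \1_[set t' | Rel (t, t')] t' +
      (2^-1 * ker (t, t') + (tau * ll t) * ll t')))).
    apply: le_Rintegral => //.
    - by apply: integrable_sumR => i; apply: integrableZR; exact: intD1.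
    - apply: integrableDR; first exact: integrableZR.
      apply: integrableDR; apply: integrableZR => //; exact: intD1.
    - move=> t' _; rewrite /ker/= [X in X * (_ * _)]indicE mem_set// mul1r.
      have r0 : 0 <= tau * ll t * ll t' by rewrite !mulr_ge0.
      rewrite (indic_section t t') !indicE; have [h|h] := pselect (Rel (t, t')).
        rewrite mem_set// mul1r mulr1.
        have h1 := near t; have h2 := near t'.
        have : \sum_i Du i t * Du i t' <= 2^-1 * (\sum_i (Du i t) ^+ 2 + \sum_i (Du i t') ^+ 2).
          rewrite -big_split/= mulr_sumr; apply: ler_sum => i _.
          by have := sqr_ge0 (Du i t - Du i t'); rewrite sqrrB mulr2n; lra.
        move=> h3; rewrite -/(Du _) in h1 h2; rewrite -/mm in h1 h2.
        have e1 : \sum_i Du i t ^+ 2 <= mm t := h1.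
        have e2 : \sum_i Du i t' ^+ 2 <= mm t' := h2.
        lra.
      by rewrite memNset// mul0r !mulr0 !add0r -mulrA; exact: far_slices.
  have i1 := integrableZR (mm t / 2) iR.
  have i2 := integrableZR 2^-1 iker.
  have i3 := integrableZR (tau * ll t) (intD1 bll).
  rewrite (RintegralD measurableT i1 (integrableDR i2 i3)) (RintegralD measurableT i2 i3).
  rewrite (RintegralZl _ measurableT iR) (RintegralZl _ measurableT iker).
  rewrite (RintegralZl _ measurableT (intD1 bll)) integral_indic_fin//.
  rewrite -/L [tau * L * _]mulrAC lerD2r.
  have : mm t / 2 * fine (m1 [set t' | Rel (t, t')]) <= mm t / 2 * alpha.
    by rewrite ler_wpM2l ?divr_ge0//; exact: fine_le_alpha.
  lra.
have j1 := integrableZR (alpha / 2) (intD1 bmm).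
have j2 := integrableZR 2^-1 (intD1 bsk).
have j3 := integrableZR (tau * L) (intD1 bll).
apply: (@le_trans _ _ (\int[m1]_t
    ((alpha / 2) * mm t + (2^-1 * slice m1 ker t + (tau * L) * ll t)))).
  apply: le_Rintegral => //.
  - by apply: integrable_sumR => i; apply: integrableZR; exact: intD1.
  - exact: integrableDR j1 (integrableDR j2 j3).
rewrite (RintegralD measurableT j1 (integrableDR j2 j3)) (RintegralD measurableT j2 j3).
rewrite (RintegralZl _ measurableT (intD1 bmm)) (RintegralZl _ measurableT (intD1 bsk)).
rewrite (RintegralZl _ measurableT (intD1 bll)) -/L -/X.
have := int_ker; rewrite -/X; lra.
Qed.

End TTstar.
(** * Invariance of Lebesgue measure and orthogonality on the torus *)

Section LebesgueInvariance.
Context {R : realType}.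
Notation mu := (@lebesgue_measure R).

(** By uniqueness of Lebesgue measure only half-open intervals have to be tested. *)
Let pushE (f : R -> R) (mf : measurable_fun setT f) :
  (forall a b : R, a < b -> mu (f @^-1` `]a, b]) = (b - a)%:E) ->
  forall A, measurable A -> mu (f @^-1` A) = mu A.
Proof.
move=> hf A mA.
have mf' : @measurable_fun _ _ (measurableTypeR R) (measurableTypeR R) setT f by exact: mf.
pose nu := @measure_function_pushforward__canonical__measure_function_Measure
  _ _ (measurableTypeR R) (measurableTypeR R) R mu f mf'.
symmetry; apply: (@lebesgue_measure_unique R nu) => //.
move=> X /ocitvP[->|[[a b]/= ab ->]].
  by rewrite !measure0.
rewrite [RHS](_ : _ = (b - a)%:E); last exact: hf.
by rewrite lebesgue_measure_itv/= lte_fin ab.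
Qed.

Lemma lebesgue_measure_shift (c : R) A : measurable A ->
  mu [set x | A (x - c)] = mu A.
Proof.
move=> mA; apply: (pushE (f := fun x => x - c)) => //.
  exact: measurable_funB.
move=> a b ab; rewrite (_ : _ @^-1` _ = `]a + c, b + c]%classic).
  by rewrite lebesgue_measure_itv/= lte_fin ltrD2r ab -EFinB; congr (_%:E); ring.
by apply/seteqP; split => x /=; rewrite !in_itv/= ltrBrDr lerBlDr.
Qed.

Lemma lebesgue_measure_reflect (c : R) A : measurable A ->
  mu [set x | A (c - x)] = mu A.
Proof.
move=> mA; apply: (pushE (f := fun x => c - x)) => //.
  exact: measurable_funB.
move=> a b ab; rewrite (_ : _ @^-1` _ = `[c - b, c - a[%classic).
  by rewrite lebesgue_measure_itv/= lte_fin ltrD2l ltrN2 ab -EFinB; congr (_%:E); ring.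
apply/seteqP; split => x /=; rewrite !in_itv/=.
  by move=> /andP[h1 h2]; apply/andP; split; lra.
by move=> /andP[h1 h2]; apply/andP; split; lra.
Qed.

End LebesgueInvariance.

Section MeasurableTrig.
Context d {T : measurableType d} {R : realType} (D : set T) (g : T -> R).

Lemma measurable_cos : measurable_fun D g -> measurable_fun D (fun x => cos (g x)).
Proof.
by move=> mg; apply: measurableT_comp mg; apply: continuous_measurable_fun; exact: continuous_cos.
Qed.

Lemma measurable_sin : measurable_fun D g -> measurable_fun D (fun x => sin (g x)).
Proof.
by move=> mg; apply: measurableT_comp mg; apply: continuous_measurable_fun; exact: continuous_sin.
Qed.

End MeasurableTrig.

Section CosIntegral.
Context {R : realType}.
Notation mu := (@lebesgue_measure R).

Definition unit_itv : set R := `[0, 1[%classic.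

Lemma measurable_unit_itv : measurable unit_itv.
Proof. exact: measurable_itv. Qed.

Lemma lebesgue_unit_itv : mu unit_itv = 1%E.
Proof. by rewrite /unit_itv lebesgue_measure_itv/= lte_fin ltr01 sube0. Qed.

Lemma integral_cos_unit (k : int) (psi : R) : k != 0 ->
  \int[mu]_x (\1_unit_itv x * cos (2 * pi * (k%:~R * x) + psi)) = 0.
Proof.
move=> k0.
have k0R : 2 * pi * k%:~R != 0 :> R.
  by rewrite !mulf_neq0 ?pnatr_eq0 ?intr_eq0// gt_eqF// pi_gt0.
pose f x : R := cos (2 * pi * (k%:~R * x) + psi).
pose F x : R := (2 * pi * k%:~R)^-1 * sin (2 * pi * (k%:~R * x) + psi).
have -> : \int[mu]_x (\1_unit_itv x * f x) = \int[mu]_(x in unit_itv) f x.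
  rewrite [RHS]Rintegral_mkcond; apply: eq_Rintegral => x _.
  rewrite patchE indicE; by case: ifP; rewrite ?mul1r ?mul0r.
have dlin (x : R) : is_derive x (1 : R) (fun x : R => 2 * pi * (k%:~R * x) + psi) (2 * pi * k%:~R).
  by apply: is_derive_eq; rewrite addr0 /GRing.scale/= mulr1.
have dF (x : R) : is_derive x (1 : R) F (f x).
  by apply: is_derive_eq; rewrite /GRing.scale/= mulrCA mulVf// mulr1.

have cF (x : R) : {for x, continuous F}.
  by have [/derivable1_diffP/differentiable_continuous] := dF x.
have cf : continuous f.
  move=> x; apply: continuous_comp; last exact: continuous_cos.
  by have [/derivable1_diffP/differentiable_continuous] := dlin x.
rewrite /unit_itv Rintegral_itv_bndo_bndc; last first.
  apply: (@integrableS _ _ _ mu `[0, 1]%classic) => //.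
    by apply: subset_itvl; rewrite bnd_simp.
  apply: continuous_compact_integrable; first exact: segment_compact.
  exact: continuous_subspaceT.
rewrite /Rintegral (@continuous_FTC2 R f F 0 1)//.
- rewrite /F !mulr1 !mulr0 add0r [2 * pi * k%:~R + psi]addrC (@periodic_int R sin) ?subee//.
  exact: sinD2pi.
- exact: continuous_subspaceT.
- split; first by move=> x _; exact: (@ex_derive _ _ _ _ _ _ _ (dF x)).
  + by apply: cvg_at_right_filter; exact: cF.
  + by apply: cvg_at_left_filter; exact: cF.
- by move=> x _; rewrite derive1E; exact: (@derive_val _ _ _ _ _ _ _ (dF x)).
Qed.

End CosIntegral.
(** If one of the two summands of the phase integrates to zero whatever constant is
    added to it, so does the sum: integrate first in that variable. *)
Section CosOrth.
Context d1 d2 {T1 : measurableType d1} {T2 : measurableType d2} {R : realType}.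
Context (m1 : {sigma_finite_measure set T1 -> \bar R}).
Context (m2 : {sigma_finite_measure set T2 -> \bar R}).
Variables (D1 : set T1) (D2 : set T2).
Hypotheses (mD1 : measurable D1) (fD1 : (m1 D1 < +oo)%E).
Hypotheses (mD2 : measurable D2) (fD2 : (m2 D2 < +oo)%E).
Variables (a1 : T1 -> R) (a2 : T2 -> R).
Hypotheses (ma1 : measurable_fun setT a1) (ma2 : measurable_fun setT a2).

Let w psi (z : T1 * T2) : R := \1_(D1 `*` D2) z * cos (a1 z.1 + a2 z.2 + psi).

Let bw psi : bsupp (D1 `*` D2) (w psi).
Proof.
apply: (@bsupp_indic _ _ _ _ _ _ 1) => //.
- exact: measurableX.
- apply: measurable_cos; apply: measurable_funD => //.
  by apply: measurable_funD; exact: measurableT_comp.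
- by move=> x _; exact: cos_max.
Qed.

Let indicX (z : T1 * T2) : \1_(D1 `*` D2) z = \1_D1 z.1 * \1_D2 z.2 :> R.
Proof. by case: z => x y; rewrite !indicE in_setX/=; case: (_ \in _); case: (_ \in _); rewrite ?mulr1 ?mulr0. Qed.

Lemma cos_orth_l psi : (forall psi, \int[m1]_x (\1_D1 x * cos (a1 x + psi)) = 0) ->
  \int[(m1 \x m2)%E]_z (\1_(D1 `*` D2) z * cos (a1 z.1 + a2 z.2 + psi)) = 0.
Proof.
move=> h; rewrite -(Rintegral_slice2 mD1 fD1 mD2 fD2 (bw psi)).
under eq_Rintegral => y _.
  rewrite (_ : Rintegral _ _ _ = 0); first over.
  transitivity (\int[m1]_t (\1_D2 y * (\1_D1 t * cos (a1 t + (a2 y + psi))))).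
    by apply: eq_Rintegral => t _; rewrite /w indicX/= addrA; ring.
  rewrite RintegralZl ?h ?mulr0//; apply: (bsupp_integrable mD1 fD1).
  apply: (@bsupp_indic _ _ _ _ _ _ 1) => //; last by move=> x _; exact: cos_max.
  by apply: measurable_cos; exact: measurable_funD.
by rewrite Rintegral_cst// mul0r.
Qed.

Lemma cos_orth_r psi : (forall psi, \int[m2]_x (\1_D2 x * cos (a2 x + psi)) = 0) ->
  \int[(m1 \x m2)%E]_z (\1_(D1 `*` D2) z * cos (a1 z.1 + a2 z.2 + psi)) = 0.
Proof.
move=> h; rewrite -(Rintegral_slice mD1 fD1 mD2 fD2 (bw psi)) /slice.
under eq_Rintegral => x _.
  rewrite (_ : Rintegral _ _ _ = 0); first over.
  transitivity (\int[m2]_t (\1_D1 x * (\1_D2 t * cos (a2 t + (a1 x + psi))))).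
    apply: eq_Rintegral => t _; rewrite /w indicX/= addrA [a2 t + _]addrC; ring.
  rewrite RintegralZl ?h ?mulr0//; apply: (bsupp_integrable mD2 fD2).
  apply: (@bsupp_indic _ _ _ _ _ _ 1) => //; last by move=> y _; exact: cos_max.
  by apply: measurable_cos; exact: measurable_funD.
by rewrite Rintegral_cst// mul0r.
Qed.

End CosOrth.

Section TorusOrth.
Context {R : realType}.
Notation mu := (@lebesgue_measure R).
Notation cell := (@torus_cell R).
Implicit Types (n : int * int * int) (x : R * R * R).

Let U := @unit_itv R.
Let mU : measurable U. Proof. exact: measurable_unit_itv. Qed.
Let fU : (mu U < +oo)%E. Proof. by rewrite lebesgue_unit_itv ltry. Qed.
Let U2 : (@lebesgue2 R (U `*` U) = 1)%E.
Proof. by rewrite /lebesgue2 product_measure1E//= !lebesgue_unit_itv mule1. Qed.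
Let mU2 : measurable (U `*` U). Proof. exact: measurableX. Qed.
Let fU2 : (@lebesgue2 R (U `*` U) < +oo)%E. Proof. by rewrite U2 ltry. Qed.

Lemma measurable_cell : measurable cell.
Proof. by apply: measurableX => //; exact: measurableX. Qed.

Lemma lebesgue3_cell : (@lebesgue3 R cell = 1)%E.
Proof.
have e : (@lebesgue3 R cell = @lebesgue2 R (U `*` U) * mu U)%E.
  exact: (@product_measure1E _ _ _ _ _ (@lebesgue2 R) mu _ _ mU2 mU).
by rewrite e U2 lebesgue_unit_itv mule1.
Qed.

Lemma lebesgue3_cell_fin : (@lebesgue3 R cell < +oo)%E.
Proof. by rewrite lebesgue3_cell ltry. Qed.

Let mlin (k : int) : measurable_fun setT (fun x : R => 2 * pi * (k%:~R * x)).
Proof. by apply: measurable_funM => //; exact: measurable_funM. Qed.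

Lemma measurable_dot3 n : measurable_fun setT (@dot3 R n).
Proof.
have mf : measurable_fun setT (fun x : R * R * R => x.1) by exact: measurable_fst.
have m1 : measurable_fun setT (fun x : R * R * R => x.1.1) by exact: (measurableT_comp measurable_fst mf).
have m2 : measurable_fun setT (fun x : R * R * R => x.1.2) by exact: (measurableT_comp measurable_snd mf).
have m3 : measurable_fun setT (fun x : R * R * R => x.2) by exact: measurable_snd.
by apply: measurable_funD; [apply: measurable_funD|]; apply: measurable_funM.
Qed.

Lemma integral_cos_cell n psi : n != 0 ->
  \int[@lebesgue3 R]_x (\1_cell x * cos (2 * pi * dot3 n x + psi)) = 0.
Proof.
move: n => [[n1 n2] n3] n0.
pose a2 (y : R * R) := 2 * pi * (n1%:~R * y.1) + 2 * pi * (n2%:~R * y.2).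
have ma2 : measurable_fun setT a2.
  by apply: measurable_funD;
    [exact: (measurableT_comp (mlin _) measurable_fst)|exact: (measurableT_comp (mlin _) measurable_snd)].
transitivity (\int[@lebesgue3 R]_x (\1_((U `*` U) `*` U) x *
    cos (a2 x.1 + 2 * pi * (n3%:~R * x.2) + psi))).
  apply: eq_Rintegral => x _; congr (_ * cos _).
  by rewrite /a2 /dot3/=; ring.
have [n30|n30] := eqVneq n3 0; last first.
  apply: (@cos_orth_r _ _ _ _ _ (@lebesgue2 R) mu _ _ mU2 fU2 mU fU _
    (fun y : R => 2 * pi * (n3%:~R * y)) ma2 (mlin _)) => psi'.
  exact: integral_cos_unit.
apply: (@cos_orth_l _ _ _ _ _ (@lebesgue2 R) mu _ _ mU2 fU2 mU fU _
    (fun y : R => 2 * pi * (n3%:~R * y)) ma2 (mlin _)) => psi'.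
have [n20|n20] := eqVneq n2 0; last first.
  apply: (@cos_orth_r _ _ _ _ _ mu mu _ _ mU fU mU fU (fun y : R => 2 * pi * (n1%:~R * y))
    (fun y : R => 2 * pi * (n2%:~R * y)) (mlin _) (mlin _)) => psi''.
  exact: integral_cos_unit.
have n10 : n1 != 0.
  by apply: contra_neq n0 => ->; rewrite n20 n30.
apply: (@cos_orth_l _ _ _ _ _ mu mu _ _ mU fU mU fU (fun y : R => 2 * pi * (n1%:~R * y))
    (fun y : R => 2 * pi * (n2%:~R * y)) (mlin _) (mlin _)) => psi''.
exact: integral_cos_unit.
Qed.

End TorusOrth.
(** * Waves and their kernel *)

Section ExpSums.
Context {R : realType}.

(** The squared modulus of a sum of exponentials with real phases [a i]. *)
Definition expsum2 (I : finType) (a : I -> R) : R :=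
  (\sum_i cos (a i)) ^+ 2 + (\sum_i sin (a i)) ^+ 2.

Lemma expsum2_shift (I : finType) (a : I -> R) (c : R) :
  expsum2 (fun i => a i + c) = expsum2 a.
Proof.
rewrite /expsum2; under eq_bigr do rewrite cosD.
under [X in _ + X ^+ 2]eq_bigr do rewrite sinD.
rewrite sumrB big_split/= -!mulr_suml.
set C := \sum_i cos (a i); set S := \sum_i sin (a i).
have -> : (C * cos c - S * sin c) ^+ 2 + (S * cos c + C * sin c) ^+ 2 =
  (C ^+ 2 + S ^+ 2) * (cos c ^+ 2 + sin c ^+ 2) by ring.
by rewrite cos2Dsin2 mulr1.
Qed.

Lemma expsum2_prod (A B : finType) (a : A -> R) (b : B -> R) :
  expsum2 (fun p : A * B => a p.1 + b p.2) = expsum2 a * expsum2 b.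
Proof.
rewrite /expsum2 -(pair_bigA _ (fun i j => cos (a i + b j)))/=.
rewrite -(pair_bigA _ (fun i j => sin (a i + b j)))/=.
set Ca := \sum_i cos (a i); set Sa := \sum_i sin (a i).
set Cb := \sum_i cos (b i); set Sb := \sum_i sin (b i).
have -> : \sum_i \sum_j cos (a i + b j) = Ca * Cb - Sa * Sb.
  rewrite /Ca /Cb /Sa /Sb !big_distrlr/= -sumrB; apply: eq_bigr => i _.
  by rewrite -sumrB; apply: eq_bigr => j _; rewrite cosD.
have -> : \sum_i \sum_j sin (a i + b j) = Sa * Cb + Ca * Sb.
  rewrite /Ca /Cb /Sa /Sb !big_distrlr/= -big_split/=; apply: eq_bigr => i _.
  by rewrite -big_split/=; apply: eq_bigr => j _; rewrite sinD.
ring.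
Qed.

Lemma expsum2_le (I : finType) (a : I -> R) : expsum2 a <= #|I|%:R ^+ 2.
Proof.
have h (f : I -> R) : (\sum_i f i) ^+ 2 <= #|I|%:R * \sum_i f i ^+ 2.
  have := cauchy_schwarz_sum (fun=> 1) f.
  under eq_bigr do rewrite mul1r.
  by under [X in X * _]eq_bigr do rewrite expr1n; rewrite sumr_const.
have := lerD (h (cos \o a)) (h (sin \o a)).
move=> /le_trans; apply; rewrite -mulrDr expr2 ler_wpM2l// -big_split/=.
by under eq_bigr do rewrite cos2Dsin2; rewrite sumr_const.
Qed.

Lemma expsum2_weyl2 (M N0 : nat) (y s : R) :
  expsum2 (fun i : 'I_M => 2 * pi * ((i%:Z - N0%:Z)%:~R * y + (i%:Z - N0%:Z)%:~R ^+ 2 * s))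
  = weyl2 M (y - 2 * N0%:R * s) s.
Proof.
rewrite /weyl2 !big_mkord.
rewrite -[RHS]/(expsum2 (fun i : 'I_M =>
  2 * pi * (i%:R * (y - 2 * N0%:R * s) + i%:R ^+ 2 * s))).
rewrite -[RHS](expsum2_shift _ (2 * pi * (N0%:R ^+ 2 * s - N0%:R * y))).
congr expsum2; apply/funext => i; rewrite intrD mulrNz -!pmulrn; ring.
Qed.

End ExpSums.

Section Waves.
Context {R : realType} (N0 : nat) (theta : R).
Notation cell := (@torus_cell R).
Notation M := (N0.*2.+1).
Notation J := ('I_M * 'I_M * 'I_M)%type.
Implicit Types (i k : J * bool) (j : J) (z : R * (R * R * R)).

(** The frequencies of the cube of half-side [N0], indexed from its corner. *)
Definition freq j : int * int * int :=
  ((j.1.1 : nat)%:Z - N0%:Z, (j.1.2 : nat)%:Z - N0%:Z, (j.2 : nat)%:Z - N0%:Z).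

Lemma freq_inj : injective freq.
Proof.
move=> [[a b] c] [[a' b'] c'] [] /addIr[ea] /addIr[eb] /addIr[ec].
by congr (_, _, _); apply: val_inj.
Qed.

(** The Boolean component adds a quarter turn: the vector fields [(cos, sin)] of the
    phases [(j, false)] and [(j, true)] stand for [e] and [i e], where [e] is the
    exponential of frequency [freq j]. *)
Definition phase i z : R :=
  2 * pi * (dot3 (freq i.1) z.2 + Qform theta (freq i.1) * z.1) + (i.2 : nat)%:R * (pi / 2).

Lemma measurable_phase i : measurable_fun setT (phase i).
Proof.
apply: measurable_funD => //; apply: measurable_funM => //; apply: measurable_funD.
  exact: (measurableT_comp (measurable_dot3 _) measurable_snd).
by apply: measurable_funM => //; exact: measurable_fst.
Qed.

Lemma measurable_phase_section i t : measurable_fun setT (fun x => phase i (t, x)).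
Proof. exact: (measurableT_comp (measurable_phase i) (pair1_measurable t)). Qed.

Lemma bsupp_cos_phase i t : bsupp cell (fun x => \1_cell x * cos (phase i (t, x))).
Proof.
apply: (@bsupp_indic _ _ _ _ _ _ 1) => //; first exact: measurable_cell.
  by apply: measurable_cos; exact: measurable_phase_section.
by move=> x _; exact: cos_max.
Qed.

Lemma bsupp_sin_phase i t : bsupp cell (fun x => \1_cell x * sin (phase i (t, x))).
Proof.
apply: (@bsupp_indic _ _ _ _ _ _ 1) => //; first exact: measurable_cell.
  by apply: measurable_sin; exact: measurable_phase_section.
by move=> x _; exact: sin_max.
Qed.

Lemma phase_orth t i k :
  \int[@lebesgue3 R]_x ((\1_cell x * cos (phase i (t, x))) * (\1_cell x * cos (phase k (t, x)))
    + (\1_cell x * sin (phase i (t, x))) * (\1_cell x * sin (phase k (t, x)))) = (i == k)%:R.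
Proof.
pose n := freq i.1 - freq k.1.
pose psi : R := 2 * pi * ((Qform theta (freq i.1) - Qform theta (freq k.1)) * t) +
   ((i.2 : nat)%:R - (k.2 : nat)%:R) * (pi / 2).
transitivity (\int[@lebesgue3 R]_x (\1_cell x * cos (2 * pi * dot3 n x + psi))).
  apply: eq_Rintegral => x _.
  have -> : 2 * pi * dot3 n x + psi = phase i (t, x) - phase k (t, x).
    by rewrite /n /psi /phase /dot3/= !intrD !mulrNz; ring.
  rewrite cosB indicE; case: (x \in _); rewrite ?mul1r ?mul0r ?addr0//.
have [ik|ik] := eqVneq i.1 k.1; last first.
  rewrite integral_cos_cell; last by rewrite subr_eq0 (inj_eq freq_inj).
  by case: eqVneq => // ike; rewrite ike eqxx in ik.
have -> : \int[@lebesgue3 R]_x (\1_cell x * cos (2 * pi * dot3 n x + psi)) =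
    cos psi * \int[@lebesgue3 R]_x \1_cell x.
  have ii : (@lebesgue3 R).-integrable setT (EFin \o (\1_cell : R * R * R -> R)).
    apply: integrable_indic_fin; first exact: measurable_cell.
    exact: lebesgue3_cell_fin.
  rewrite -(RintegralZl (cos psi) measurableT ii).
  apply: eq_Rintegral => x _; rewrite [LHS]mulrC; congr (cos _ * _).
  by rewrite /n ik subrr /dot3/= !mulr0z !mul0r !addr0 mulr0 add0r.
have -> : \int[@lebesgue3 R]_x (\1_cell x : R) = 1.
  rewrite integral_indic_fin; last exact: measurable_cell.
  exact: (congr1 fine lebesgue3_cell).
rewrite mulr1 /psi ik subrr mul0r mulr0 add0r.
case: i k ik {n psi} => [a b] [a' b'] /= ->.
rewrite xpair_eqE eqxx/=; case: b; case: b' => /=; rewrite ?subrr ?mul0r ?cos0//.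
  by rewrite subr0 mul1r cos_pihalf.
by rewrite sub0r mulN1r cosN cos_pihalf.
Qed.

Definition wave_re (c : J * bool -> R) z : R := \sum_i c i * cos (phase i z).
Definition wave_im (c : J * bool -> R) z : R := \sum_i c i * sin (phase i z).

Definition wave2 c z : R := wave_re c z ^+ 2 + wave_im c z ^+ 2.

Lemma wave2_ge0 c z : 0 <= wave2 c z.
Proof. by rewrite addr_ge0// sqr_ge0. Qed.

(** The real inner product of the wave with the [i]-th exponential. *)
Definition wave_dot c i z : R :=
  wave_re c z * cos (phase i z) + wave_im c z * sin (phase i z).

Lemma sum_wave_dot c z : \sum_i c i * wave_dot c i z = wave2 c z.
Proof.
rewrite /wave2 !expr2 {2}/wave_re {2}/wave_im !mulr_sumr -big_split/=.
by apply: eq_bigr => i _; rewrite /wave_dot; ring.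
Qed.

Definition kernel2 z z' : R := expsum2 (fun j => phase (j, false) z - phase (j, false) z').

(** The quadratic form is diagonal, so the kernel factors; the shifts by
    [2 N0 s] come from recentring the frequencies at the corner of the cube. *)
Lemma kernel2E z z' : let s := z.1 - z'.1 in
  kernel2 z z' = weyl2 M ((z.2.1.1 - z'.2.1.1) - 2 * N0%:R * s) s *
                 weyl2 M ((z.2.1.2 - z'.2.1.2) - 2 * N0%:R * s) s *
                 weyl2 M ((z.2.2 - z'.2.2) - 2 * N0%:R * (theta * s)) (theta * s).
Proof.
move=> s; rewrite -!expsum2_weyl2 -!expsum2_prod /kernel2.
congr expsum2; apply/funext => -[[a b] c].
rewrite /phase /dot3 /Qform /s /=; ring.
Qed.

(** Summing over the Boolean component first, the left-hand side is the real part of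
    [F z * conj (F z') * conj K], with [K] the exponential sum whose squared
    modulus is [kernel2]. *)
Lemma sum_wave_dot_le c z z' :
  \sum_i wave_dot c i z * wave_dot c i z' <=
  Num.sqrt (wave2 c z) * Num.sqrt (wave2 c z') * Num.sqrt (kernel2 z z').
Proof.
set F1 := wave_re c z; set F2 := wave_im c z.
set G1 := wave_re c z'; set G2 := wave_im c z'.
pose A := F1 * G1 + F2 * G2; pose B := F2 * G1 - F1 * G2.
pose Kc := \sum_j cos (phase (j, false) z - phase (j, false) z').
pose Ks := \sum_j sin (phase (j, false) z - phase (j, false) z').
have -> : \sum_i wave_dot c i z * wave_dot c i z' = A * Kc + B * Ks.
  rewrite -(pair_bigA _ (fun j b => wave_dot c (j, b) z * wave_dot c (j, b) z'))/=.
  rewrite /Kc /Ks !mulr_sumr -big_split/=; apply: eq_bigr => j _.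
  have sh w : phase (j, true) w = phase (j, false) w + pi / 2.
    by rewrite /phase/= mul0r addr0 mul1r.
  rewrite big_bool /wave_dot !sh !cosDpihalf !sinDpihalf cosB sinB /A /B -/F1 -/F2 -/G1 -/G2.
  rewrite /=; ring.
rewrite -!sqrtrM ?wave2_ge0//; last by rewrite mulr_ge0// wave2_ge0.
rewrite (le_trans (ler_norm _))// -sqrtr_sqr ler_wsqrtr//.
have -> : wave2 c z * wave2 c z' * kernel2 z z' = (A ^+ 2 + B ^+ 2) * (Kc ^+ 2 + Ks ^+ 2).
  have -> : kernel2 z z' = Kc ^+ 2 + Ks ^+ 2 by [].
  by rewrite /wave2 -/F1 -/F2 -/G1 -/G2 /A /B; ring.
by have := sqr_ge0 (A * Ks - B * Kc); lra.
Qed.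

(** At [z = z'] the preceding inequality reads [sum_i dot_i ^ 2 <= |F| ^ 2 M ^ 3];
    combine it with Cauchy-Schwarz in [|F| ^ 2 = sum_i c_i dot_i]. *)
Lemma wave2_le c z : wave2 c z <= (\sum_i c i ^+ 2) * M%:R ^+ 3.
Proof.
have h := cauchy_schwarz_sum c (fun i => wave_dot c i z).
rewrite sum_wave_dot in h.
have k : \sum_i wave_dot c i z ^+ 2 <= wave2 c z * M%:R ^+ 3.
  under eq_bigr do rewrite expr2.
  rewrite (le_trans (sum_wave_dot_le c z z))// -expr2 sqr_sqrtr ?wave2_ge0//.
  rewrite ler_wpM2l ?wave2_ge0//.
  rewrite -[leRHS]ger0_norm ?exprn_ge0// -sqrtr_sqr ler_wsqrtr// (le_trans (expsum2_le _))//.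
  rewrite !card_prod !card_ord !natrM le_eqVlt; apply/orP; left; apply/eqP; ring.
have [->|wn] := eqVneq (wave2 c z) 0.
  by rewrite mulr_ge0 ?exprn_ge0// sumr_ge0// => i _; exact: sqr_ge0.
have wp : 0 < wave2 c z by rewrite lt_def wn wave2_ge0.
have S0 : 0 <= \sum_i c i ^+ 2 by rewrite sumr_ge0// => i _; exact: sqr_ge0.
have := le_trans h (ler_wpM2l S0 k).
by rewrite expr2 mulrCA ler_pM2l.
Qed.

End Waves.
(** * Superlevel sets of a wave *)

Lemma absorb_half (R : realType) (S al tau lam2 X L : R) :
  X ^+ 2 <= S * (al * X + tau * L ^+ 2) -> lam2 * L ^+ 2 <= X ^+ 2 ->
  lam2 = 2 * S * tau -> X ^+ 2 <= 2 * S * al * X.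
Proof. by move=> h1 h2 e; rewrite e in h2; lra. Qed.

Section LevelSet.
Context {R : realType} (N0 : nat) (theta : R).
Notation cell := (@torus_cell R).
Notation mu := (@lebesgue_measure R).
Notation M := (N0.*2.+1).
Notation J := ('I_M * 'I_M * 'I_M)%type.
Variables (c : J * bool -> R) (a b : R).
Implicit Types (i k : J * bool) (z : R * (R * R * R)).

Notation re := (wave_re theta c).
Notation im := (wave_im theta c).
Notation F2 := (wave2 theta c).
Notation dot := (wave_dot theta c).
Let S := \sum_i c i ^+ 2.
Let I := `[a, b]%classic : set R.
Let D := I `*` cell.

Lemma measurable_wave_re : measurable_fun setT re.
Proof.
apply: measurable_sum => i; apply: measurable_funM => //.
by apply: measurable_cos; exact: measurable_phase.
Qed.

Lemma measurable_wave_im : measurable_fun setT im.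
Proof.
apply: measurable_sum => i; apply: measurable_funM => //.
by apply: measurable_sin; exact: measurable_phase.
Qed.

Lemma measurable_wave2 : measurable_fun setT F2.
Proof.
apply: measurable_funD; apply: measurable_funX.
  exact: measurable_wave_re.
exact: measurable_wave_im.
Qed.

Lemma measurable_wave_dot i : measurable_fun setT (dot i).
Proof.
apply: measurable_funD; apply: measurable_funM.
- exact: measurable_wave_re.
- by apply: measurable_cos; exact: measurable_phase.
- exact: measurable_wave_im.
- by apply: measurable_sin; exact: measurable_phase.
Qed.

Let mI : measurable I. Proof. exact: measurable_itv. Qed.
Let fI : (mu I < +oo)%E.
Proof. by rewrite /I lebesgue_measure_itv/=; case: ifP => _; rewrite ?ltry// -EFinB ltry. Qed.
Let mC : measurable cell. Proof. exact: measurable_cell. Qed.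
Let fC : (@lebesgue3 R cell < +oo)%E. Proof. exact: lebesgue3_cell_fin. Qed.
Let mD : measurable D. Proof. exact: measurableX. Qed.

Let S0 : 0 <= S. Proof. by rewrite sumr_ge0// => i _; exact: sqr_ge0. Qed.

Definition superlevel (lam2 : R) : set (R * (R * R * R)) :=
  [set z | D z /\ lam2 < F2 z].

Lemma measurable_superlevel lam2 : measurable (superlevel lam2).
Proof.
rewrite (_ : superlevel lam2 = D `&` F2 @^-1` `]lam2, +oo[%classic).
  apply: measurableI => //; rewrite -[X in measurable X]setTI.
  exact: measurable_wave2.
by apply/seteqP; split => z /=; rewrite /superlevel/= in_itv/= andbT.
Qed.

Let Cb := 2 + S * M%:R ^+ 3.
Let Cb0 : 0 <= Cb. Proof. by rewrite addr_ge0// mulr_ge0// exprn_ge0. Qed.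
Let F2_le z : F2 z <= Cb.
Proof. by rewrite (le_trans (wave2_le theta c z))// lerDr. Qed.
Let abs_le (x : R) : `|x| <= 1 + x ^+ 2.
Proof. by rewrite -real_normK ?num_real//; have := sqr_ge0 (`|x| - 1); have := normr_ge0 x; rewrite sqrrB; lra. Qed.
Let re_le z : `|re z| <= Cb.
Proof.
apply: le_trans (abs_le _) _; have := wave2_le theta c z.
by rewrite /wave2 -/S /Cb; have := sqr_ge0 (im z); lra.
Qed.
Let im_le z : `|im z| <= Cb.
Proof.
apply: le_trans (abs_le _) _; have := wave2_le theta c z.
by rewrite /wave2 -/S /Cb; have := sqr_ge0 (re z); lra.
Qed.
Let dot_le i z : `|dot i z| <= Cb.
Proof.
have := wave2_le theta c z; have := abs_le (re z); have := abs_le (im z).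
have h1 : `|re z * cos (phase theta i z)| <= `|re z| by rewrite normrM ler_piMr// cos_max.
have h2 : `|im z * sin (phase theta i z)| <= `|im z| by rewrite normrM ler_piMr// sin_max.
have := ler_normD (re z * cos (phase theta i z)) (im z * sin (phase theta i z)).
rewrite -/(dot i z) /wave2 -/S /Cb; lra.
Qed.

Section OneLevel.
Variables (lam2 : R).
Let E := superlevel lam2.
Let mE : measurable E. Proof. exact: measurable_superlevel. Qed.
Let ED : E `<=` D. Proof. by move=> z []. Qed.

Let bE (v : R * (R * R * R) -> R) : measurable_fun setT v -> (forall z, `|v z| <= Cb) ->
  bsupp D (fun z => \1_E z * v z).
Proof.
move=> mv vB; split; first exact: measurable_funM.
exists Cb; split => // z; rewrite normrM mulrC.
rewrite (ger0_norm (_ : 0 <= \1_E z))//; apply: ler_pM => //.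
rewrite !indicE; case: (boolP (z \in E)) => // /set_mem /ED zD.
by rewrite mem_set.
Qed.

Let u i z := \1_E z * dot i z.
Let m z := \1_E z * F2 z.
Let l z := \1_E z * Num.sqrt (F2 z).
Let bu i : bsupp D (u i). Proof. by apply: bE => //; exact: measurable_wave_dot. Qed.
Let bm : bsupp D m.
Proof. by apply: bE => [|z]; [exact: measurable_wave2|rewrite ger0_norm ?wave2_ge0]. Qed.
Let bl : bsupp D l.
Proof.
apply: bE => [|z].
  by apply: (measurableT_comp _ measurable_wave2); apply: continuous_measurable_fun; exact: sqrt_continuous.
rewrite ger0_norm//.
have w0 := wave2_ge0 theta c z; have := wave2_le theta c z; rewrite -/S.
have := sqrtr_ge0 (F2 z); have := sqr_sqrtr w0; have := abs_le (Num.sqrt (F2 z)).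
rewrite (ger0_norm (sqrtr_ge0 _)) /Cb; lra.
Qed.

Let near_bessel t : \sum_i (slice (@lebesgue3 R) (u i) t) ^+ 2 <= slice (@lebesgue3 R) m t.
Proof.
pose p i (x : R * R * R) := \1_cell x * cos (phase theta i (t, x)).
pose q i (x : R * R * R) := \1_cell x * sin (phase theta i (t, x)).
pose g (x : R * R * R) := \1_E (t, x) * re (t, x).
pose h (x : R * R * R) := \1_E (t, x) * im (t, x).
have bg : bsupp cell g.
  by apply: (bsupp_section t (bE _ _)); [exact: measurable_wave_re|].
have bh : bsupp cell h.
  by apply: (bsupp_section t (bE _ _)); [exact: measurable_wave_im|].
have := @bessel _ _ _ (@lebesgue3 R) _ p q
  (fun i => @bsupp_sqi _ _ _ (@lebesgue3 R) _ mC fC _ (bsupp_cos_phase theta i t))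
  (fun i => @bsupp_sqi _ _ _ (@lebesgue3 R) _ mC fC _ (bsupp_sin_phase theta i t))
  (phase_orth theta t) g h (@bsupp_sqi _ _ _ (@lebesgue3 R) _ mC fC _ bg) (@bsupp_sqi _ _ _ (@lebesgue3 R) _ mC fC _ bh).
have EC x : \1_E (t, x) * \1_cell x = \1_E (t, x) :> R.
  rewrite !indicE; case: (boolP ((t, x) \in E)) => [/set_mem/ED[_ xC]|_]; last by rewrite mul0r.
  by rewrite (mem_set xC) mulr1.
have -> : \int[@lebesgue3 R]_x (g x ^+ 2 + h x ^+ 2) = slice (@lebesgue3 R) m t.
  apply: eq_Rintegral => x _; rewrite /g /h /m /wave2 !exprMn -mulrDr; congr (_ * _).
  by rewrite indicE; case: (_ \in _); rewrite ?expr1n ?expr0n.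
have e i : slice (@lebesgue3 R) (u i) t = \int[@lebesgue3 R]_x (g x * p i x + h x * q i x).
  apply: eq_Rintegral => x _.
  by rewrite /u /g /h /p /q /wave_dot -[in LHS](EC x); ring.
move=> B; have -> : \sum_i (slice (@lebesgue3 R) (u i) t) ^+ 2 =
    \sum_i (\int[@lebesgue3 R]_x (g x * p i x + h x * q i x)) ^+ 2.
  exact: (eq_bigr _ (fun i _ => congr1 (fun r : R => r ^+ 2) (e i))).
exact: B.
Qed.

(** This is [TTstar_bound] with [u i], [m] and [l] the products of the
    indicator of [E] with the inner products, [|F| ^ 2] and [|F|].  On [E] one has
    [|F| <= |F| ^ 2 / sqrt lam2], which bounds the integral of [l] by that of [m]
    and lets half of [X ^ 2] be absorbed. *)
Lemma superlevel_bound (A : set R) (W alpha : R) : 0 <= W -> measurable A ->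
  (mu A <= alpha%:E)%E -> lam2 = 2 * S * Num.sqrt (W ^+ 3) ->
  (forall s y, `|s| <= b - a -> ~ A s -> weyl2 M y s <= W /\ weyl2 M y (theta * s) <= W) ->
  Num.sqrt (W ^+ 3) * \int[@lebesgue_spacetime R]_z \1_E z <= alpha.
Proof.
move=> W0 mA Aalpha lamE hA; set tau := Num.sqrt (W ^+ 3).
have tau0 : 0 <= tau by exact: sqrtr_ge0.
have alpha0 : 0 <= alpha by rewrite -lee_fin (le_trans _ Aalpha).
have iE0 : 0 <= \int[@lebesgue_spacetime R]_z \1_E z by apply: Rintegral_ge0.
(* For S = 0 the wave vanishes and the superlevel set is empty. *)
have [Sz|Sn] := eqVneq S 0.
  have -> : \int[@lebesgue_spacetime R]_z \1_E z = 0.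
    under eq_Rintegral => z _.
      rewrite indicE memNset; first over.
      move=> [_]; rewrite lamE Sz mulr0 mul0r ltNge => /negP; apply.
      by rewrite (le_trans (wave2_le _ _ _))// -/S Sz mul0r.
    by rewrite Rintegral_cst// mul0r.
  by rewrite mulr0.
have [->|taun] := eqVneq tau 0; first by rewrite mul0r.
have Sp : 0 < S by rewrite lt_def Sn.
have taup : 0 < tau by rewrite lt_def taun.
have lamp : 0 < lam2 by rewrite lamE !mulr_gt0.
pose Rel : set (R * R) := [set tt | A (tt.1 - tt.2)].
have mRel : measurable Rel.
  rewrite -[X in measurable X]setTI.
  by apply: (measurable_funB measurable_fst measurable_snd).
have Rel1 t : (mu [set t' | Rel (t, t')] <= alpha%:E)%E.
  by rewrite /Rel/= (lebesgue_measure_reflect t mA).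
have Rel2 t' : (mu [set t | Rel (t, t')] <= alpha%:E)%E.
  by rewrite /Rel/= (lebesgue_measure_shift t' mA).
have far t t' y y' : ~ Rel (t, t') ->
    \sum_i u i (t, y) * u i (t', y') <= tau * (l (t, y) * l (t', y')).
  move=> nR; rewrite /u /l.
  have -> : \sum_i \1_E (t, y) * dot i (t, y) * (\1_E (t', y') * dot i (t', y')) =
    (\1_E (t, y) * \1_E (t', y')) * \sum_i dot i (t, y) * dot i (t', y').
    by rewrite mulr_sumr; apply: eq_bigr => i _; ring.
  have -> : tau * (\1_E (t, y) * Num.sqrt (F2 (t, y)) * (\1_E (t', y') * Num.sqrt (F2 (t', y')))) =
    (\1_E (t, y) * \1_E (t', y')) * (tau * (Num.sqrt (F2 (t, y)) * Num.sqrt (F2 (t', y')))) by ring.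
  rewrite !indicE; case: (boolP ((t, y) \in E)) => [/set_mem zE|_]; last by rewrite !mul0r.
  case: (boolP ((t', y') \in E)) => [/set_mem zE'|_]; last by rewrite mulr0 !mul0r.
  rewrite !mul1r (le_trans (sum_wave_dot_le _ _ _ _))// mulrC ler_wpM2r//.
  have [[tI _] _] := zE; have [[tI' _] _] := zE'.
  have st : `|t - t'| <= b - a.
    move: tI tI'; rewrite /I/= !in_itv/= ler_norml => /andP[? ?] /andP[? ?].
    by apply/andP; split; lra.
  rewrite /tau ler_wsqrtr// kernel2E/=.
  have hs y := hA _ y st nR.
  have w0 x s : 0 <= weyl2 M x s :> R by rewrite addr_ge0// sqr_ge0.
  have -> : W ^+ 3 = W * W * W by ring.
  apply: ler_pM; rewrite ?mulr_ge0//; last exact: (hs _).2.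
  by apply: ler_pM => //; exact: (hs _).1.
have m0 z : 0 <= m z by rewrite mulr_ge0// wave2_ge0.
have l0 z : 0 <= l z by rewrite mulr_ge0.
have TT := @TTstar_bound _ _ _ _ _ mu (@lebesgue3 R) _ _ mI fI mC fC _ u m l bu bm bl m0 l0
  Rel alpha tau mRel tau0 Rel1 Rel2 near_bessel far.
have fD : (@lebesgue_spacetime R D < +oo)%E.
  have e : (@lebesgue_spacetime R D = mu I * @lebesgue3 R cell)%E.
    exact: (@product_measure1E _ _ _ _ _ mu (@lebesgue3 R) _ _ mI mC).
  by rewrite e lebesgue3_cell mule1.
pose X := \int[@lebesgue_spacetime R]_z m z.
pose L := \int[@lebesgue_spacetime R]_z l z.
have iint v : bsupp D v -> (@lebesgue_spacetime R).-integrable setT (EFin \o v).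
  by move=> bv; exact: (@bsupp_integrable _ _ _ (@lebesgue_spacetime R) _ mD fD _ bv).
have X0 : 0 <= X by apply: Rintegral_ge0 => z _.
have TT' : \sum_i (\int[@lebesgue_spacetime R]_z u i z) ^+ 2 <= alpha * X + tau * L ^+ 2.
  exact: TT.
have XE : X = \sum_i c i * \int[@lebesgue_spacetime R]_z u i z.
  transitivity (\int[@lebesgue_spacetime R]_z (\sum_i c i * u i z)).
    apply: eq_Rintegral => z _; rewrite /m -sum_wave_dot mulr_sumr.
    by apply: eq_bigr => i _; rewrite /u; ring.
  rewrite Rintegral_sum; last by move=> i; apply: integrableZR; exact: iint.
  by apply: eq_bigr => i _; rewrite RintegralZl//; exact: iint.
have X2 : X ^+ 2 <= S * (alpha * X + tau * L ^+ 2).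
  by rewrite XE (le_trans (cauchy_schwarz_sum _ _))// -XE ler_wpM2l.
have L0 : 0 <= L by apply: Rintegral_ge0 => z _.
(* On E the modulus exceeds sqrt lam2. *)
have LX : Num.sqrt lam2 * L <= X.
  rewrite /L /X -RintegralZl//; last exact: iint.
  apply: le_Rintegral => //; [by apply: integrableZR; exact: iint|exact: iint|].
  move=> z _; rewrite /l /m mulrCA indicE; case: (boolP (z \in E)); last by rewrite !mul0r.
  move=> /set_mem[_ /ltW zE]; rewrite !mul1r -[leRHS](sqr_sqrtr (wave2_ge0 _ _ _)) expr2.
  by rewrite ler_wpM2r// ler_wsqrtr.
have LX2 : lam2 * L ^+ 2 <= X ^+ 2.
  rewrite -[X in X * _](sqr_sqrtr (ltW lamp)) -exprMn.
  by rewrite ler_sqr ?nnegrE// mulr_ge0.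
have EX : lam2 * \int[@lebesgue_spacetime R]_z \1_E z <= X.
  have fE : (@lebesgue_spacetime R E < +oo)%E.
    apply: le_lt_trans fD; apply: le_measure; [exact/mem_set|exact/mem_set|exact: ED].
  have iE : (@lebesgue_spacetime R).-integrable setT (EFin \o (\1_E : R * (R * R * R) -> R)).
    exact: (@integrable_indic_fin _ _ _ (@lebesgue_spacetime R) _ mE fE).
  rewrite -(RintegralZl _ measurableT iE).
  apply: le_Rintegral => //; [exact: integrableZR|exact: iint|].
  move=> z _; rewrite /m mulrC indicE; case: (boolP (z \in E)); last by rewrite !mul0r.
  by move=> /set_mem[_ /ltW zE]; rewrite !mul1r.
have XX : X ^+ 2 <= 2 * S * alpha * X.
  exact: absorb_half X2 LX2 lamE.
have X3 : X <= 2 * S * alpha.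
  have [->|Xn] := eqVneq X 0; first by rewrite !mulr_ge0.
  have Xp : 0 < X by rewrite lt_def Xn.
  by move: XX; rewrite expr2 ler_pM2r.
have := le_trans EX X3; rewrite lamE -/tau -!mulrA ler_pM2l// ler_pM2l//.
Qed.

End OneLevel.
End LevelSet.
(** * Summation over levels *)

Section Geometric.
Context {R : realType}.

Lemma sum_geometric_le (x : R) (K : nat) : 0 <= x < 1 ->
  \sum_(k < K) x ^+ k <= (1 - x)^-1.
Proof.
move=> /andP[x0 x1]; have d0 : 0 < 1 - x by rewrite subr_gt0.
have e : (\sum_(k < K) x ^+ k) * (1 - x) = 1 - x ^+ K.
  elim: K => [|K IH]; first by rewrite big_ord0 mul0r expr0 subrr.
  by rewrite big_ord_recr/= mulrDl IH exprS; ring.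
rewrite -(ler_pM2r d0) e mulVf ?gt_eqF//.
by rewrite lerBlDr lerDl exprn_ge0.
Qed.

Lemma exp_small (x B : R) : 0 <= x <= 1 / 2 -> exists K : nat, x ^+ K * B <= 1.
Proof.
move=> /andP[x0 x1]; exists (Num.truncn `|B|).+1; set K := _.+1.
have BK : `|B| <= K%:R by rewrite ltW// truncnS_gt.
apply: (@le_trans _ _ (x ^+ K * `|B|)); first by rewrite ler_wpM2l ?exprn_ge0// ler_norm.
apply: (@le_trans _ _ ((1 / 2) ^+ K * 2 ^+ K)); last first.
  by rewrite -exprMn divfK// expr1n.
apply: ler_pM; rewrite ?exprn_ge0//; first by rewrite lerXn2r// nnegrE; lra.
by rewrite (le_trans BK)// -natrX ler_nat ltnW// ltn_expl.
Qed.

Lemma powR_exprn (x a : R) (k : nat) : 0 <= x -> (x ^+ k) `^ a = (x `^ a) ^+ k.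
Proof.
by move=> x0; rewrite -powR_mulrn// powRAC powR_mulrn// powR_ge0.
Qed.

(** If some level lies below [w], the term just before the first such level alone
    dominates [w ^ h]; otherwise the last term does. *)
Lemma layer_bound (w h : R) (lam : nat -> R) (K : nat) : 0 <= w -> 0 <= h ->
  (forall k, 0 <= lam k) -> w <= lam 0%N ->
  w `^ h <= \sum_(k < K) lam k `^ h * (lam k.+1 < w)%R%:R + lam K `^ h.
Proof.
move=> w0 h0 lam0 wl; elim: K => [|K IH].
  by rewrite big_ord0 add0r ge0_ler_powR ?nnegrE.
have s0 n : 0 <= \sum_(k < n) lam k `^ h * (lam k.+1 < w)%R%:R.
  by apply: sumr_ge0 => k _; rewrite mulr_ge0// powR_ge0.
rewrite big_ord_recr/=; have [lw|lw] := ltP (lam K.+1) w.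
  by rewrite mulr1 (le_trans IH)// lerDl powR_ge0.
rewrite mulr0 addr0; apply: ler_wpDl; first exact: s0.
by rewrite ge0_ler_powR ?nnegrE.
Qed.

End Geometric.

Section WaveLp.
Context {R : realType}.
Notation cell := (@torus_cell R).
Notation mu := (@lebesgue_measure R).

(** The exceptional set is the union of those for the time variables [s] and
    [theta s], at [rho = 16 ^ k]; then [W = M ^ 2 / rho] is the square of
    [M / 4 ^ k]. *)
Lemma superlevel_measure (theta ell eps : R) : 0 < theta -> 0 <= ell -> 0 < eps ->
  exists C : R, 0 < C /\ forall (a b : R) (N0 k : nat) (c : _ -> R) (M : R), b - a = ell ->
    M = (N0.*2.+1)%:R ->
    \int[@lebesgue_spacetime R]_z
      \1_(superlevel (N0:=N0) theta c a b (2 * (\sum_i c i ^+ 2) * (M / 4 ^+ k) ^+ 3)) z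
    <= C * (16 `^ (2 + eps) * 64) ^+ k / M ^+ 5.
Proof.
move=> th0 ell0 eps0.
have [C1 [C10 H1]] := weyl_exceptional (ltr01 : 0 < 1 :> R) ell0 eps0.
have [C2 [C20 H2]] := weyl_exceptional th0 ell0 eps0.
exists (C1 + C2); split; first exact: addr_gt0.
move=> a b N0 k c M ab ME.
pose rho : R := 16 ^+ k.
have rho1 : 1 <= rho by rewrite exprn_ege1//; lra.
have rho0 : 0 < rho by lra.
have M0 : (0 < N0.*2.+1)%N by [].
have Mp : 0 < M by rewrite ME ltr0n.
have [A1 [mA1 muA1 hA1]] := H1 _ rho M0 rho1.
have [A2 [mA2 muA2 hA2]] := H2 _ rho M0 rho1.
rewrite -ME in muA1 hA1 muA2 hA2.
pose W := M ^+ 2 / rho.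
have WE : W = (M / 4 ^+ k) ^+ 2.
  by rewrite expr_div_n -exprM mulnC exprM /W /rho; congr (_ / _ ^+ _); rewrite expr2 -natrM.
have W0 : 0 <= W by rewrite WE sqr_ge0.
have q0 : 0 < M / 4 ^+ k by rewrite divr_gt0// exprn_gt0.
have tauE : Num.sqrt (W ^+ 3) = (M / 4 ^+ k) ^+ 3.
  by rewrite WE -exprM mulnC exprM sqrtr_sqr ger0_norm// exprn_ge0// ltW.
pose alpha := (C1 + C2) * rho `^ (2 + eps) / M ^+ 2.
have := @superlevel_bound R N0 theta c a b _ (A1 `|` A2) W alpha W0 (measurableU _ _ mA1 mA2).
rewrite tauE => /(_ (2 * (\sum_i c i ^+ 2) * (M / 4 ^+ k) ^+ 3)).
move=> /(_ _ erefl) sb.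
have {}sb : (M / 4 ^+ k) ^+ 3 * \int[@lebesgue_spacetime R]_z
      \1_(superlevel (N0:=N0) theta c a b (2 * (\sum_i c i ^+ 2) * (M / 4 ^+ k) ^+ 3)) z <= alpha.
  apply: sb.
    apply: (le_trans (measureU2 mu mA1 mA2)).
    by rewrite /alpha !mulrDl EFinD; apply: leeD.
  move=> s y; rewrite ab => sl nA; split; last by apply: hA2 => // ?; apply: nA; right.
  by rewrite -[s]mul1r; apply: hA1 => // ?; apply: nA; left.
rewrite -(ler_pM2l (exprn_gt0 3 q0)) (le_trans sb)// le_eqVlt; apply/orP; left; apply/eqP.
have e64 : 64 ^+ k = (4 ^+ k) ^+ 3 :> R.
  by rewrite -!exprM mulnC exprM; congr (_ ^+ _); rewrite -natrX.
rewrite /alpha /rho powR_exprn// [(_ * 64) ^+ k]exprMn e64.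
by field; rewrite !gt_eqF// exprn_gt0.
Qed.

Definition slab (a b : R) : set (R * (R * R * R)) := `[a, b]%classic `*` cell.

Lemma measurable_slab (a b : R) : measurable (slab a b).
Proof. by apply: measurableX; [exact: measurable_itv|exact: measurable_cell]. Qed.

Lemma lebesgue_slab (a b : R) : a <= b -> (@lebesgue_spacetime R (slab a b) = (b - a)%:E)%E.
Proof.
move=> ab.
have e : (@lebesgue_spacetime R (slab a b) = mu `[a, b]%classic * @lebesgue3 R cell)%E.
  exact: (@product_measure1E _ _ _ _ _ mu (@lebesgue3 R) _ _ (measurable_itv _) measurable_cell).
rewrite e lebesgue3_cell mule1 lebesgue_measure_itv/= lte_fin.
case: ltP => // ba; have -> : a = b by apply/eqP; rewrite eq_le ab.
by rewrite subrr.
Qed.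

Lemma bsupp_wave_power (theta h a b : R) (N0 : nat) (c : _ -> R) : 0 <= h ->
  bsupp (slab a b) (fun z => \1_(slab a b) z * (wave2 (N0:=N0) theta c z) `^ h).
Proof.
move=> h0.
apply: (@bsupp_indic _ _ _ _ (measurable_slab a b) _
  (((\sum_i c i ^+ 2) * (N0.*2.+1)%:R ^+ 3) `^ h)).
- exact: (measurableT_comp (measurable_powR h) (measurable_wave2 theta c)).
- exact: powR_ge0.
- move=> z _; rewrite ger0_norm ?powR_ge0//.
  have S0 : 0 <= \sum_i c i ^+ 2 by rewrite sumr_ge0// => i _; exact: sqr_ge0.
  rewrite ge0_ler_powR ?nnegrE//; [exact: wave2_ge0| |exact: wave2_le].
  by apply: mulr_ge0 => //; exact: exprn_ge0.
Qed.

Lemma powR2_lt1 (e : R) : e < 0 -> 2 `^ e < 1 :> R.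
Proof.
move=> e0; rewrite -[e]opprK powRN invf_lt1 ?powR_gt0//.
have e1 : 1 = 1 `^ (- e) :> R by rewrite powR1.
by rewrite [ltLHS]e1; apply: gt0_ltr_powR; rewrite ?oppr_gt0// ?nnegrE//; lra.
Qed.

(** The level [k] contributes [(lam k) ^ h] times the measure of the superlevel set at
    [lam (k + 1)], that is, up to a factor free of [k], the [k]-th power of
    [x = 64 ^ (- h) * 16 ^ (2 + eps) * 64], and [x < 1] is the gap assumption.  The
    number [K] of levels is taken so large that what lies below the last level is
    negligible. *)
Lemma wave_power_bound (theta ell h eps : R) : 0 < theta -> 0 <= ell -> 0 < eps ->
  1 <= h -> 4 * eps + 14 < 6 * h ->
  exists C : R, 0 < C /\ forall (a b : R) (N0 : nat) (c : _ -> R) (M : R), a <= b -> b - a = ell ->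
    M = (N0.*2.+1)%:R ->
    \int[@lebesgue_spacetime R]_z (\1_(slab a b) z * (wave2 (N0:=N0) theta c z) `^ h) <=
    C * (\sum_i c i ^+ 2) `^ h * M `^ (3 * h - 5).
Proof.
move=> th0 ell0 eps0 h1 hgap.
have [C0 [C0p HC]] := superlevel_measure th0 ell0 eps0.
have h0 : 0 <= h by lra.
pose g : R := 64 `^ (- h); pose D0 : R := 16 `^ (2 + eps) * 64; pose x := g * D0.
have p0 (y e : R) : 0 < y -> 0 < y `^ e by move=> ?; exact: powR_gt0.
have n64 : 0 < 64 :> R by rewrite ltr0n.
have n16 : 0 < 16 :> R by rewrite ltr0n.
have g0 : 0 < g by exact: p0.
have D00 : 0 < D0 by apply: mulr_gt0 => //; exact: p0.
have x0 : 0 < x by exact: mulr_gt0.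
(* In base 2 the exponent of x is 14 + 4 eps - 6 h. *)
have x1 : x < 1.
  have e64 : 64 = 2 `^ 6 :> R by rewrite powR_mulrn// -natrX.
  have e16 : 16 = 2 `^ 4 :> R by rewrite powR_mulrn// -natrX.
  rewrite /x /g /D0 e16 [in X in _ * X]e64 {1}e64 -!powRrM mulrA -!powRD; try by rewrite pnatr_eq0 implybT.
  apply: powR2_lt1; lra.
have ghalf : 0 <= g <= 1 / 2.
  rewrite ltW//= /g powRN div1r lef_pV2 ?posrE ?p0//.
  apply: (@le_trans _ _ (64 `^ 1)); first by rewrite powRr1 ?ler_nat// ltW.
  by rewrite ler_powR// ler1n.
exists (2 `^ h * (C0 * D0 * (1 - x)^-1 + 1)); split.
  apply: mulr_gt0; first exact: p0.
  by apply: addr_gt0 => //; rewrite mulr_gt0 ?invr_gt0 ?subr_gt0// mulr_gt0.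
move=> a b N0 c M ab abl ME.
set S := \sum_i c i ^+ 2.
have S0 : 0 <= S by rewrite sumr_ge0// => i _; exact: sqr_ge0.
have Mp : 0 < M by rewrite ME ltr0n.
have M3 : 0 < M ^+ 3 by rewrite exprn_gt0.
have M5 : 0 < M ^+ 5 by rewrite exprn_gt0.
pose lam (k : nat) : R := 2 * S * (M / 4 ^+ k) ^+ 3.
have q0 k : 0 <= M / 4 ^+ k by rewrite divr_ge0 ?exprn_ge0// ltW.
have lam0 k : 0 <= lam k := mulr_ge0 (mulr_ge0 (ler0n _ 2) S0) (exprn_ge0 3 (q0 k)).
pose B := (2 * S) `^ h * (M ^+ 3) `^ h.
have B0 : 0 <= B by rewrite mulr_ge0// powR_ge0.
have lamE k : lam k `^ h = B * g ^+ k.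
  have -> : lam k = (2 * S) * (M ^+ 3 * (64^-1) ^+ k).
    have e64 : 64 ^+ k = (4 ^+ k) ^+ 3 :> R.
      by rewrite -!exprM mulnC exprM; congr (_ ^+ _); rewrite -natrX.
    by rewrite exprVn e64 /lam expr_div_n.
  have v64 : 0 <= 64^-1 :> R by rewrite invr_ge0 ltW.
  have S20 : 0 <= 2 * S by exact: mulr_ge0.
  have vk : 0 <= 64^-1 ^+ k :> R by exact: exprn_ge0.
  have Mvk : 0 <= M ^+ 3 * 64^-1 ^+ k by exact: (mulr_ge0 (ltW M3)).
  rewrite (powRM h S20 Mvk) (powRM h (ltW M3) vk) mulrA -/B.
  rewrite powR_exprn//; congr (_ * _ ^+ _).
  by rewrite /g -powR_inv1 ?(ltW n64)// -powRrM mulN1r.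
have [K hK] := exp_small (ell * M ^+ 5) ghalf.
pose E k := superlevel (N0:=N0) theta c a b (lam k).
have HE k : \int[@lebesgue_spacetime R]_z \1_(E k) z <= C0 * D0 ^+ k / M ^+ 5.
  exact: HC.
pose w (z : R * (R * R * R)) := wave2 (N0:=N0) theta c z.
have w0 z : 0 <= w z by exact: wave2_ge0.
have wle z : w z <= S * M ^+ 3 by rewrite ME; exact: wave2_le.
have mDab := measurable_slab a b.
have vD := lebesgue_slab ab.
have fD : (@lebesgue_spacetime R (slab a b) < +oo)%E by rewrite vD ltry.
have mE k : measurable (E k) by exact: measurable_superlevel.
have fE k : (@lebesgue_spacetime R (E k) < +oo)%E.
  apply: le_lt_trans fD; apply: le_measure; [exact: (mem_set (mE k))|exact: (mem_set mDab)|].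
  by move=> z [].
have iE k : (@lebesgue_spacetime R).-integrable setT (EFin \o (\1_(E k) : R * (R * R * R) -> R)).
  exact: (@integrable_indic_fin _ _ _ (@lebesgue_spacetime R) _ (mE k) (fE k)).
have iD : (@lebesgue_spacetime R).-integrable setT (EFin \o (\1_(slab a b) : R * (R * R * R) -> R)).
  exact: (@integrable_indic_fin _ _ _ (@lebesgue_spacetime R) _ mDab fD).
have bw := @bsupp_wave_power theta h a b N0 c h0.
have iR k : (@lebesgue_spacetime R).-integrable setT
    (EFin \o (fun z : R * (R * R * R) => B * g ^+ k * \1_(E k.+1) z)).
  exact: integrableZR (iE k.+1).
have iS : (@lebesgue_spacetime R).-integrable setT
    (EFin \o (fun z : R * (R * R * R) => \sum_(k < K) B * g ^+ k * \1_(E k.+1) z)).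
  exact: (integrable_sumR _ (fun k : 'I_K => iR k)).
have iL := integrableZR (B * g ^+ K) iD.
apply: (@le_trans _ _ (\int[@lebesgue_spacetime R]_z
    (\sum_(k < K) B * g ^+ k * \1_(E k.+1) z + B * g ^+ K * \1_(slab a b) z))).
  apply: le_Rintegral => //.
  - exact: (@bsupp_integrable _ _ _ (@lebesgue_spacetime R) _ mDab fD _ bw).
  - exact: integrableDR iS iL.
  - move=> z _; rewrite [\1_(slab a b) z]indicE; case: (boolP (z \in slab a b)) => [/set_mem zD|_]; last first.
      rewrite mul0r mulr0 addr0; apply: sumr_ge0 => k _.
      by rewrite mulr_ge0// mulr_ge0// exprn_ge0// ltW.
    rewrite mul1r mulr1.
    have wl0 : w z <= lam 0%N.
      rewrite (le_trans (wle z))// /lam expr0 divr1 ler_pM2r//.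
      by rewrite ler_peMl// ler1n.
    have := layer_bound K (w0 z) h0 lam0 wl0.
    rewrite lamE; move=> /le_trans; apply; rewrite lerD2r.
    apply: ler_sum => k _; rewrite lamE indicE.
    case: (ltP (lam k.+1) (w z)) => hw; last by rewrite mulr0 mulr_ge0// mulr_ge0// exprn_ge0// ltW.
    by rewrite mem_set.
rewrite (RintegralD measurableT iS iL) (RintegralZl _ measurableT iD).
rewrite (Rintegral_sum _ (fun k : 'I_K => iR k)).
have -> : \int[@lebesgue_spacetime R]_z (\1_(slab a b) z : R) = ell.
  rewrite integral_indic_fin//; rewrite -abl; exact: (congr1 fine vD).
have sumle : \sum_(k < K) \int[@lebesgue_spacetime R]_z (B * g ^+ k * \1_(E k.+1) z) <=
    B / M ^+ 5 * (C0 * D0 * (1 - x)^-1).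
  apply: (@le_trans _ _ (\sum_(k < K) (B / M ^+ 5 * (C0 * D0)) * x ^+ k)).
    apply: ler_sum => k _; rewrite (RintegralZl _ measurableT (iE _)).
    apply: le_trans (ler_wpM2l _ (HE k.+1)) _; first by rewrite mulr_ge0// exprn_ge0// ltW.
    rewrite le_eqVlt; apply/orP; left; apply/eqP.
    by rewrite /x [(g * D0) ^+ k]exprMn [D0 ^+ k.+1]exprS; field; rewrite gt_eqF.
  rewrite -mulr_sumr -[leLHS]mulrA.
  apply: (ler_wpM2l (divr_ge0 B0 (ltW M5))).
  apply: (ler_wpM2l (ltW (mulr_gt0 C0p D00))).
  by apply: sum_geometric_le; rewrite ltW.
have restle : B * g ^+ K * ell <= B / M ^+ 5.
  rewrite -mulrA ler_wpM2l// -[leRHS]mul1r ler_pdivlMr//.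
  by rewrite -mulrA.
have -> : 2 `^ h * (C0 * D0 * (1 - x)^-1 + 1) * S `^ h * M `^ (3 * h - 5) =
    B / M ^+ 5 * (C0 * D0 * (1 - x)^-1) + B / M ^+ 5.
  have -> : B / M ^+ 5 = 2 `^ h * S `^ h * M `^ (3 * h - 5).
    rewrite /B powRM// -!mulrA; congr (_ * (_ * _)).
    rewrite powRB; last by rewrite (gt_eqF Mp) implybT.
    rewrite powRrM [M `^ 3]powR_mulrn ?(ltW Mp)//; congr (_ / _).
    by rewrite powR_mulrn ?(ltW Mp).
  by rewrite -!mulrA; ring.
exact: lerD.
Qed.

End WaveLp.
(** * From the datum to its wave *)

Lemma normc_nneg (R : rcfType) (z : R[i]) : 0 <= ComplexField.Normc.normc z.
Proof. by case: z => x y; exact: sqrtr_ge0. Qed.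

Lemma normc_sqr (R : rcfType) (z : R[i]) :
  ComplexField.Normc.normc z ^+ 2 = complex.Re z ^+ 2 + complex.Im z ^+ 2.
Proof. by case: z => x y /=; rewrite sqr_sqrtr// addr_ge0// sqr_ge0. Qed.

Section Lnorms.
Context d (T : measurableType d) (R : realType) (mu : {measure set T -> \bar R}).
Variable D : set T.

Lemma cLnormE (p : R) (f : T -> R[i]) : p != 0 ->
  cLnorm mu D p f = ((\int[mu]_x (\1_D x * (ComplexField.Normc.normc (f x)) `^ p)%:E) `^ p^-1)%E.
Proof.
move=> p0; rewrite /cLnorm unlock; congr (_ `^ _)%E; apply: eq_integral => x _.
rewrite patchE indicE; case: (x \in D) => /=.
  by rewrite mul1r ger0_norm ?normc_nneg.
by rewrite mul0r normr0 powR0.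
Qed.

End Lnorms.

(** The coefficients of the datum in the real system are the real and imaginary parts
    of its Fourier coefficients, and Bessel's inequality bounds their squares. *)
Section Reduction.
Context {R : realType} (theta : R) (f : R * R * R -> R[i]) (N0 : nat).
Notation cell := (@torus_cell R).
Notation nu := (@lebesgue3 R).
Notation J := ('I_(N0.*2.+1) * 'I_(N0.*2.+1) * 'I_(N0.*2.+1))%type.
Hypothesis fL2 : L2_torus f.

Let f1 x : R := \1_cell x * complex.Re (f x).
Let f2 x : R := \1_cell x * complex.Im (f x).
Let normf2 x : R := f1 x ^+ 2 + f2 x ^+ 2.

Let indic_sqr x : (\1_cell x : R) ^+ 2 = \1_cell x.
Proof. by rewrite indicE; case: (_ \in _); rewrite ?expr1n ?expr0n. Qed.

Let normf2E x : normf2 x = \1_cell x * ComplexField.Normc.normc (f x) ^+ 2.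
Proof. by rewrite normc_sqr /normf2 !exprMn indic_sqr; ring. Qed.

Let mf1 : measurable_fun setT f1.
Proof.
have [_ [m1 _] _] := fL2; have := (measurable_restrictT _ measurable_cell).1 m1.
congr measurable_fun; apply/funext => x; rewrite patchE /f1 indicE.
by case: (x \in _); rewrite ?mul1r ?mul0r.
Qed.

Let mf2 : measurable_fun setT f2.
Proof.
have [_ [_ m2] _] := fL2; have := (measurable_restrictT _ measurable_cell).1 m2.
congr measurable_fun; apply/funext => x; rewrite patchE /f2 indicE.
by case: (x \in _); rewrite ?mul1r ?mul0r.
Qed.

Let mnormf2 : measurable_fun setT normf2.
Proof. by apply: measurable_funD; exact: measurable_funX. Qed.

Let L2E : L2norm_torus f = ((\int[nu]_x (normf2 x)%:E) `^ 2^-1)%E.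
Proof.
rewrite /L2norm_torus cLnormE//; congr (_ `^ _)%E; apply: eq_integral => x _.
by rewrite normf2E powR_mulrn ?normc_nneg.
Qed.

Let inormf2 : nu.-integrable setT (EFin \o normf2).
Proof.
apply/integrableP; split; first exact/measurable_EFinP.
have [_ _] := fL2; rewrite L2E => /lty_poweRy.
rewrite invr_neq0// => /(_ isT); apply: le_lt_trans.
rewrite le_eqVlt; apply/orP; left; apply/eqP; apply: eq_integral => x _.
by rewrite /= ger0_norm// /normf2 addr_ge0// sqr_ge0.
Qed.

Let sqi1 : sqi nu f1.
Proof.
split => //; apply: (le_integrable measurableT _ _ inormf2).
  by apply/measurable_EFinP; exact: measurable_funX.
move=> x _; rewrite /= lee_fin !ger0_norm ?sqr_ge0 ?addr_ge0 ?sqr_ge0// lerDl; exact: sqr_ge0.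
Qed.

Let sqi2 : sqi nu f2.
Proof.
split => //; apply: (le_integrable measurableT _ _ inormf2).
  by apply/measurable_EFinP; exact: measurable_funX.
move=> x _; rewrite /= lee_fin !ger0_norm ?sqr_ge0 ?addr_ge0 ?sqr_ge0// lerDr; exact: sqr_ge0.
Qed.

Definition wave_coef (i : J * bool) : R :=
  if i.2 then complex.Im (fourier_coef f (freq i.1)) else complex.Re (fourier_coef f (freq i.1)).

Let p (i : J * bool) (x : R * R * R) : R := \1_cell x * cos (phase theta i (0, x)).
Let q (i : J * bool) (x : R * R * R) : R := \1_cell x * sin (phase theta i (0, x)).

Lemma wave_coefE i : wave_coef i = \int[nu]_x (f1 x * p i x + f2 x * q i x).
Proof.
case: i => j bb; rewrite /wave_coef /fourier_coef /cintegral/=.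
have e x : complex.Re (f x * e2pi (- dot3 (freq j) x)) =
    complex.Re (f x) * cos (2 * pi * dot3 (freq j) x) + complex.Im (f x) * sin (2 * pi * dot3 (freq j) x).
  by case: (f x) => u v /=; rewrite mulrN cosN sinN; ring.
have e' x : complex.Im (f x * e2pi (- dot3 (freq j) x)) =
    complex.Im (f x) * cos (2 * pi * dot3 (freq j) x) - complex.Re (f x) * sin (2 * pi * dot3 (freq j) x).
  by case: (f x) => u v /=; rewrite mulrN cosN sinN; ring.
case: bb; rewrite Rintegral_mkcond; apply: eq_Rintegral => x _; rewrite patchE /f1 /f2 /p /q /phase/=.
  rewrite mulr0 addr0 mul1r cosDpihalf sinDpihalf indicE.
  by case: (x \in _); rewrite ?e' ?mul1r ?mul0r ?addr0//; ring.
rewrite mulr0 mul0r !addr0 indicE.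
by case: (x \in _); rewrite ?e ?mul1r ?mul0r ?addr0.
Qed.

Lemma sum_wave_coef_le : \sum_i wave_coef i ^+ 2 <= \int[nu]_x normf2 x.
Proof.
have mC := @measurable_cell R; have fC := @lebesgue3_cell_fin R.
have B := @bessel _ _ _ nu _ p q
  (fun i => @bsupp_sqi _ _ _ nu _ mC fC _ (bsupp_cos_phase theta i 0))
  (fun i => @bsupp_sqi _ _ _ nu _ mC fC _ (bsupp_sin_phase theta i 0))
  (phase_orth theta 0) f1 f2 sqi1 sqi2.
rewrite (eq_bigr _ (fun i _ => congr1 (fun r : R => r ^+ 2) (wave_coefE i))).
exact: B.
Qed.

Lemma L2norm_torusE : L2norm_torus f = ((\int[nu]_x normf2 x) `^ 2^-1)%:E.
Proof.
rewrite L2E -poweR_EFin; congr (_ `^ _)%E; rewrite /Rintegral fineK//.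
by apply: integrable_fin_num.
Qed.

End Reduction.
Section Schrodinger.
Context {R : realType}.

Lemma cube_truncn (N : R) : 0 <= N -> cube N `<=` @cube R (Num.truncn N)%:R.
Proof.
move=> N0 n [h1 h2 h3].
have aux (k : int) : `|k%:~R| <= N -> `|k%:~R| <= (Num.truncn N)%:R :> R.
  by rewrite -intr_norm -natr_absz ler_nat truncn_ge_nat.
by split; exact: aux.
Qed.

Lemma mem_freq_cube (N0 : nat) (j : 'I_(N0.*2.+1) * 'I_(N0.*2.+1) * 'I_(N0.*2.+1)) :
  @cube R N0%:R (freq j).
Proof.
have aux (i : 'I_(N0.*2.+1)) : `|((i : nat)%:Z - N0%:Z)%:~R : R| <= N0%:R.
  by rewrite -intr_norm pmulrn ler_int; have := ltn_ord i; lia.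
by split; exact: aux.
Qed.

Lemma cube_freq (N0 : nat) n : @cube R N0%:R n ->
  exists j : 'I_(N0.*2.+1) * 'I_(N0.*2.+1) * 'I_(N0.*2.+1), n = freq j.
Proof.
move: n => [[n1 n2] n3] [/= h1 h2 h3].
have aux (k : int) : `|k%:~R : R| <= N0%:R -> exists i : 'I_(N0.*2.+1), k = (i : nat)%:Z - N0%:Z.
  rewrite -intr_norm pmulrn ler_int => hk.
  have kb : (absz (k + N0%:Z)%R < N0.*2.+1)%N by lia.
  by exists (Ordinal kb) => /=; lia.
have [i1 ->] := aux _ h1; have [i2 ->] := aux _ h2; have [i3 ->] := aux _ h3.
by exists (i1, i2, i3).
Qed.

Lemma cube_mono (N N' : R) : N <= N' -> cube N `<=` cube N'.
Proof. by move=> NN n [h1 h2 h3]; split; exact: le_trans NN. Qed.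

Let Re_sum (I : finType) (F : I -> R[i]) :
  complex.Re (\sum_i F i) = \sum_i complex.Re (F i).
Proof.
by apply: (big_morph (@complex.Re R)) => // -[? ?] [? ?].
Qed.
Let Im_sum (I : finType) (F : I -> R[i]) :
  complex.Im (\sum_i F i) = \sum_i complex.Im (F i).
Proof.
by apply: (big_morph (@complex.Im R)) => // -[? ?] [? ?].
Qed.

(** Once the summation cube contains the support of the Fourier coefficients the
    partial sums no longer change, so the limit is the finite sum. *)
Lemma schrodinger_wave (theta : R) f (N0 : nat) t x :
  [set n | fourier_coef f n != 0] `<=` @cube R N0%:R ->
  schrodinger (Qform theta) f t x =
    (wave_re theta (@wave_coef R f N0) (t, x) +i* wave_im theta (@wave_coef R f N0) (t, x))%C.
Proof.
move=> supp.
pose F n : R[i]^o := fourier_coef f n * e2pi (dot3 n x + Qform theta n * t).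
have sumE (K : nat) : (N0 <= K)%N ->
    \sum_(n \in @cube R K%:R) F n = \sum_(j : 'I_(N0.*2.+1) * 'I_(N0.*2.+1) * 'I_(N0.*2.+1)) F (freq j).
  move=> NK; have cNK : @cube R N0%:R `<=` @cube R K%:R by apply: cube_mono; rewrite ler_nat.
  pose r := [seq freq j | j <- enum {: 'I_(N0.*2.+1) * 'I_(N0.*2.+1) * 'I_(N0.*2.+1)}].
  rewrite (fsbigE r).
  - rewrite big_mkcond (eq_big_seq F); first by rewrite big_map big_enum.
    move=> n /mapP[j _ ->]; rewrite mem_set//; apply: cNK => //; exact: mem_freq_cube.
  - by rewrite map_inj_uniq ?enum_uniq//; exact: freq_inj.
  - by move=> n /= /mapP[j _ ->]; apply: cNK => //; exact: mem_freq_cube.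
  - move=> n _ nr; rewrite /F.
    have [->|fn] := eqVneq (fourier_coef f n) 0; first by rewrite mul0r.
    have [j nj] := cube_freq (supp _ fn).
    by move: nr; rewrite nj /r map_f// mem_enum.
have -> : schrodinger (Qform theta) f t x =
    \sum_(j : 'I_(N0.*2.+1) * 'I_(N0.*2.+1) * 'I_(N0.*2.+1)) F (freq j).
  rewrite /schrodinger; apply: (@lim_near_cst R[i]^o); first exact: norm_hausdorff.
  by exists N0 => // K /= NK; exact: sumE.
set z := \sum_j _.
have -> : z = (complex.Re z +i* complex.Im z)%C by case: z.
congr (_ +i* _)%C.
  rewrite Re_sum /wave_re -(pair_bigA _ (fun j b => wave_coef f (j, b) * cos (phase theta (j, b) (t, x))))/=.
  apply: eq_bigr => j _; rewrite big_bool /wave_coef /phase/= mul0r addr0 mul1r cosDpihalf.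
  by rewrite /F; case: (fourier_coef f (freq j)) => u v /=; ring.
rewrite Im_sum /wave_im -(pair_bigA _ (fun j b => wave_coef f (j, b) * sin (phase theta (j, b) (t, x))))/=.
apply: eq_bigr => j _; rewrite big_bool /wave_coef /phase/= mul0r addr0 mul1r sinDpihalf.
by rewrite /F; case: (fourier_coef f (freq j)) => u v /=; ring.
Qed.

End Schrodinger.

Theorem propositionB1 (R : realType) (p theta3 ell : R)
    (hp : 14 / 3 < p) (htheta3 : 0 < theta3) (hell : 0 <= ell) :
  exists C : R, 0 < C /\
    forall a b : R, a <= b -> b - a = ell ->
    forall N : R, 1 <= N ->
    forall f : R * R * R -> R[i], L2_torus f ->
      [set n | fourier_coef f n != 0] `<=` cube N ->
      (cLnorm (@lebesgue_spacetime R) (`[a, b] `*` @torus_cell R) p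
         (fun tx => schrodinger (Qform theta3) f tx.1 tx.2)
       <= (C * N `^ (3 / 2 - 5 / p))%:E * L2norm_torus f)%E.
Proof.
have p0 : 0 < p by lra.
have pn0 : p != 0 by rewrite gt_eqF.
(* With h = p / 2 the gap 6 h - 14 - 4 eps equals (3 p - 14) / 2. *)
have eps0 : 0 < (3 * p - 14) / 8 by lra.
have h1 : 1 <= p / 2 by lra.
have hgap : 4 * ((3 * p - 14) / 8) + 14 < 6 * (p / 2) by lra.
have [C [C0 HC]] := wave_power_bound htheta3 hell eps0 h1 hgap.
pose e := 3 * (p / 2) - 5.
have e0 : 0 <= e by rewrite /e; lra.
have t3 : 0 < 3 :> R by rewrite ltr0n.
exists ((C * 3 `^ e) `^ p^-1); split.
  by apply: powR_gt0; apply: mulr_gt0 => //; exact: powR_gt0.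
move=> a b ab abl N N1 f fL2 supp.
have N_ge0 : 0 <= N by lra.
pose N0 := Num.truncn N.
have N01 : (0 < N0)%N by rewrite truncn_gt0.
have N0N : N0%:R <= N by rewrite truncn_le.
have supp0 : [set n | fourier_coef f n != 0] `<=` @cube R N0%:R.
  by apply: subset_trans supp _; exact: cube_truncn.
pose M : R := (N0.*2.+1)%:R.
have M0 : 0 <= M by [].
have M3 : M <= 3 * N.
  have : 1 <= N0%:R :> R by rewrite ler1n.
  rewrite /M -natr1 -mul2n natrM; lra.
pose c := @wave_coef R f N0.
set Z := \int[@lebesgue3 R]_x
  ((\1_(@torus_cell R) x * complex.Re (f x)) ^+ 2 + (\1_(@torus_cell R) x * complex.Im (f x)) ^+ 2).
have Z0 : 0 <= Z by apply: Rintegral_ge0 => x _; rewrite addr_ge0// sqr_ge0.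
have S0 : 0 <= \sum_i c i ^+ 2 by apply: sumr_ge0 => i _; exact: sqr_ge0.
have SZ : \sum_i c i ^+ 2 <= Z := sum_wave_coef_le theta3 N0 fL2.
have mD := @measurable_slab R a b.
have fD : (@lebesgue_spacetime R (slab a b) < +oo)%E by rewrite lebesgue_slab// ltry.
have key := HC a b N0 c M ab abl erefl.
set V := \int[_]_z _ in key.
have V0 : 0 <= V by apply: Rintegral_ge0 => z _; rewrite mulr_ge0// powR_ge0.
have -> : cLnorm (@lebesgue_spacetime R) (`[a, b] `*` @torus_cell R) p
         (fun tx => schrodinger (Qform theta3) f tx.1 tx.2) = (V `^ p^-1)%:E.
  rewrite cLnormE// -poweR_EFin; congr (_ `^ _)%E.
  rewrite /V /Rintegral fineK; last first.
    apply: integrable_fin_num => //.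
    apply: (@bsupp_integrable _ _ _ (@lebesgue_spacetime R) _ mD fD).
    by apply: bsupp_wave_power; lra.
  apply: eq_integral => -[t x] _; congr (_ * _)%:E.
  rewrite (schrodinger_wave _ _ _ supp0)/= -/(wave2 theta3 c (t, x)).
  rewrite -powR12_sqrt ?wave2_ge0// -powRrM; congr (_ `^ _).
  by rewrite mulrC.
rewrite (L2norm_torusE fL2) -EFinM lee_fin.
have -> : (C * 3 `^ e) `^ p^-1 * N `^ (3 / 2 - 5 / p) * Z `^ 2^-1 =
    (C * Z `^ (p / 2) * (3 * N) `^ e) `^ p^-1.
  have X0 (x r : R) : 0 <= x `^ r := powR_ge0 x r.
  rewrite (powRM _ (ltW t3) N_ge0) !powRM ?mulr_ge0 ?X0 ?(ltW C0)// -!powRrM.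
  have -> : p / 2 * p^-1 = 2^-1 by field; rewrite pn0.
  have -> : e * p^-1 = 3 / 2 - 5 / p by rewrite /e; field; rewrite pn0.
  by ring.
apply: ge0_ler_powR; rewrite ?nnegrE ?invr_ge0 ?(ltW p0)//.
  by rewrite !mulr_ge0 ?powR_ge0// ltW.
apply: le_trans key _.
apply: ler_pM; rewrite ?mulr_ge0 ?powR_ge0 ?(ltW C0)//.
  apply: ler_wpM2l; first exact: ltW.
  by apply: ge0_ler_powR; rewrite ?nnegrE//; lra.
by apply: ge0_ler_powR; rewrite ?nnegrE// mulr_ge0// ltW.
Qed.
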